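(* Let $n\ge 1$ and let $\nu,\mu,\lambda$ be partitions with $\ell(\nu)\le 2n-1$, $\ell(\mu)\le n$, $\lambda$ even, and $\lambda,\mu\subseteq\nu$. Let $c:\operatorname{LR}(\nu/\mu,\lambda)\to \operatorname{LR}^{\nu}_{\mu,\lambda}$ be the companion map and let $U=\mathrm{rect}\circ C\circ\hat P\circ\varphi:\operatorname{LR}^{\nu}_{\mu,\lambda}\to\operatorname{LR}^{\nu}_{\lambda,\mu}$ (all notation as in the context). Then the composition $U\circ c:\operatorname{LR}(\nu/\mu,\lambda)\to\operatorname{LR}^{\nu}_{\lambda,\mu}$ restricts to a bijection $$\operatorname{LRS}(\nu/\mu,\lambda)\ \xrightarrow{\ \sim\ }\ \operatorname{LRK}^{\nu}_{\lambda,\mu}.$$ Consequently, taking the union over all even partitions $\lambda$, this composition induces a bijection between $\operatorname{LRS}(\nu,\mu):=\bigcup_{\lambda \text{ even}}\operatorname{LRS}(\nu/\mu,\lambda)$ and $\operatorname{LRK}(\nu,\mu):=\bigcup_{\lambda\text{ even}}\operatorname{LRK}^{\nu}_{\lambda,\mu}$.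
   Context: Partitions: $\nu=(\nu_1\ge\nu_2\ge\cdots)$ of nonnegative integers, eventually $0$; $\ell(\nu)$ is the number of nonzero parts; $|\nu|=\sum\nu_i$; identified with Young diagrams (English convention). A partition $\lambda$ is even if $\lambda_{2i-1}=\lambda_{2i}$ for all $i\ge1$. Semistandard tableaux take values in $\{1,\dots,2n\}$ (boxes of an inner shape $\mu$ of a skew shape $\nu/\mu$ are regarded as filled with $0$ and ignored). The reverse row word $w(T)$ of a tableau is obtained by reading the positive entries of each row from right to left, starting from the top row and going down. The content of a word/tableau is $(\alpha_1,\alpha_2,\dots)$ with $\alpha_i$ the number of occurrences of $i$. A word $w_1\cdots w_l$ is Yamanouchi if for every $k$ the content of $w_1\cdots w_k$ is a partition. $\operatorname{LR}(\nu/\mu,\lambda)$: semistandard tableaux of skew shape $\nu/\mu$ and content $\lambda$ whose reverse row word is Yamanouchi. For such $T$, its companion tableau $c(T)$ is the tableau of shape $\lambda$ whose $k$-th row contains, in weakly increasing order, the row indices (in $\nu$) of all the boxes of $T$ containing the entry $k$ (with multiplicity). Let $T_\mu$ be the tableau of shape $\mu$ whose $i$-th row is filled with $i$'s. A semistandard Young tableau $R$ is $\mu$-dominant if the concatenation $w(T_\mu)w(R)$ is Yamanouchi. $\operatorname{LR}^{\nu}_{\mu,\lambda}$ denotes the set of $\mu$-dominant semistandard Young tableaux of shape $\lambda$ and content $\nu-\mu$; $c$ is a bijection $\operatorname{LR}(\nu/\mu,\lambda)\to\operatorname{LR}^\nu_{\mu,\lambda}$. Sundaram property: $T\in\operatorname{LR}(\nu/\mu,\lambda)$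 has it if for each $i=0,1,\dots,\ell(\lambda)/2$ every occurrence of the entry $2i+1$ in $T$ lies in row $n+i$ or above of $\nu$; $\operatorname{LRS}(\nu/\mu,\lambda)$ is the set of such $T$. Rectification $\mathrm{rect}(X)$ of a skew semistandard tableau $X$ is its jeu de taquin rectification, i.e. the unique semistandard Young tableau whose reading word is Knuth equivalent to that of $X$ (Knuth relations: $xzy\equiv zxy$ if $x\le y<z$; $yxz\equiv yzx$ if $x<y\le z$). The Schützenberger involution $S$ on semistandard Young tableaux with entries in $\{1,\dots,2n\}$: $S(T)$ is the rectification of the skew tableau obtained by rotating $T$ by $180^\circ$ and replacing every entry $x$ by $2n+1-x$; $S(T)$ has the same shape as $T$. A tableau of shape $\mu$ (with $\ell(\mu)\le n$) has the Kwon property if every entry in row $i$ is at least $2i-1$, for $i=1,\dots,n$. $\operatorname{LRK}^{\nu}_{\lambda,\mu}$ is the set of $T\in\operatorname{LR}^{\nu}_{\lambda,\mu}$ (i.e. $\lambda$-dominant semistandard tableaux of shape $\mu$ and content $\nu-\lambda$) such that $S(T)$ has the Kwon property. Let $m=2n$; all partitions are regarded as having $m$ parts. A GT pattern is an array $P=(p_{i,j})_{1\le j\le i\le m}$ of nonnegative integers with $p_{i+1,j}\ge p_{i,j}\ge p_{i+1,j+1}$. For a GT pattern $P$ let $P_i=(p_{i,1},\dots,p_{i,i},0,\dots,0)$ ($m$ parts), $K=p_{m,1}$, $Q_i=(K-(P_i)_m,K-(P_i)_{m-1},\dots,K-(P_i)_1)$ for $1\le i\le m$ and $Q_0=(K,\dots,K)$.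 Then $Q_m\subseteq Q_{m-1}\subseteq\cdots\subseteq Q_0$ and the contretableau $C(P)$ is the filling of the $m\times K$ rectangle $Q_0$ in which boxes of $Q_m$ get $0$ and boxes of $Q_{m-i}/Q_{m-i+1}$ get $i$ ($1\le i\le m$); it is a semistandard tableau of skew shape $Q_0/Q_m$. For $R\in\operatorname{LR}^\nu_{\mu,\lambda}$, let $p_{i,j}$ be the number of entries $\le i$ in row $j$ of $R$ ($1\le j\le i\le m$), and define $\varphi(R)=(h_{i,j})_{0\le j\le i\le m}$ by $h_{i,j}=\sum_{k=1}^{j}p_{i,k}+\mu_1+\cdots+\mu_i$ (so $h_{0,0}=0$). For an array $h=(h_{i,j})_{0\le j\le i\le m}$ define $\hat P(h)=(\hat p_{i,k})_{1\le k\le i\le m}$ by $\hat p_{i,k}=h_{m-i+k,\,m-i}-h_{m-i+k-1,\,m-i}$. It is known (Kushwaha–Raghavan–Viswanath) that $U=\mathrm{rect}\circ C\circ\hat P\circ\varphi$ is a well-defined bijection $\operatorname{LR}^\nu_{\mu,\lambda}\to\operatorname{LR}^\nu_{\lambda,\mu}$. *)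

(* Defs.v *)
From Stdlib Require Import Relation_Operators.
From mathcomp Require Import all_boot.
From mathcomp Require Import boolp classical_sets functions.

Set Implicit Arguments.
Unset Strict Implicit.
Unset Printing Implicit Defensive.

Local Open Scope classical_set_scope.
Local Open Scope nat_scope.

(** * Partitions *)

(* Trailing zeros are dropped, so that equality of sequences is equality of
   partitions and [size nu] is the length of [nu]. *)
Definition is_part (nu : seq nat) : bool := sorted geq nu && (0 \notin nu).

(* Parts, rows, columns and array indices are numbered from 1 throughout;
   [part nu 0] is never used. *)
Definition part (nu : seq nat) (i : nat) : nat := nth 0 nu i.-1.

Definition even_part (lam : seq nat) : Prop :=
  forall i, 1 <= i -> part lam (i.*2).-1 = part lam i.*2.

Definition included (mu nu : seq nat) : Prop :=
  forall i, 1 <= i -> part mu i <= part nu i.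

Definition in_diagram (nu : seq nat) (i j : nat) : bool :=
  (1 <= i) && (1 <= j <= part nu i).

(** * Tableaux *)

(* A filling of a Young diagram, row by row from the top; the boxes of the
   inner shape of a skew tableau are filled with 0. *)
Definition tableau := seq (seq nat).

Definition trow (T : tableau) (i : nat) : seq nat := nth [::] T i.-1.

Definition entry (T : tableau) (i j : nat) : nat := nth 0 (trow T i) j.-1.

Definition semistandard (nu mu : seq nat) (T : tableau) : Prop :=
  [/\ shape T = nu,
      forall i j, in_diagram nu i j -> (entry T i j == 0) = in_diagram mu i j,
      forall i j, in_diagram nu i j -> in_diagram nu i j.+1 ->
        ~~ in_diagram mu i j -> entry T i j <= entry T i j.+1
    & forall i j, in_diagram nu i j -> in_diagram nu i.+1 j ->
        ~~ in_diagram mu i j -> entry T i j < entry T i.+1 j].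

Definition values_le (m : nat) (T : tableau) : bool := all (all (geq m)) T.

(* The reverse row word w(T). *)
Definition rrword (T : tableau) : seq nat :=
  flatten [seq rev [seq x <- r | 0 < x] | r <- T].

Definition yamanouchi (w : seq nat) : Prop :=
  forall k i, 1 <= i -> count_mem i.+1 (take k w) <= count_mem i (take k w).

(** * Littlewood-Richardson tableaux and their companions *)

Definition LR (n : nat) (nu mu lam : seq nat) : set tableau :=
  [set T | [/\ semistandard nu mu T, values_le n.*2 T,
               forall i, 1 <= i -> count_mem i (rrword T) = part lam i
             & yamanouchi (rrword T)]].

(* The largest entry of a tableau in [LR n nu mu lam] is the length of [lam],
   so its companion has shape [lam]. *)
Definition companion (T : tableau) : tableau :=
  [seq flatten [seq nseq (count_mem k (trow T i)) i | i <- iota 1 (size T)]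
  | k <- iota 1 (\max_(x <- flatten T) x)].

Definition row_tableau (mu : seq nat) : tableau :=
  [seq nseq (part mu i) i | i <- iota 1 (size mu)].

Definition dominant (mu : seq nat) (R : tableau) : Prop :=
  yamanouchi (rrword (row_tableau mu) ++ rrword R).

(* LR^nu_{mu,lam}.  The content condition is additive, so that the set is empty
   when mu is not included in nu. *)
Definition LRdom (n : nat) (nu mu lam : seq nat) : set tableau :=
  [set R | [/\ semistandard lam [::] R, values_le n.*2 R,
               forall i, 1 <= i ->
                 part mu i + count_mem i (rrword R) = part nu i
             & dominant mu R]].

Definition sundaram (n : nat) (lam : seq nat) (T : tableau) : Prop :=
  forall i, i <= (size lam)./2 ->
  forall r, 1 <= r <= size T -> (i.*2).+1 \in trow T r -> r <= n + i.

Definition LRS (n : nat) (nu mu lam : seq nat) : set tableau :=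
  [set T | LR n nu mu lam T /\ sundaram n lam T].

(** * Rectification and the Schützenberger involution *)

Inductive knuth_step : seq nat -> seq nat -> Prop :=
| KnuthXZY u v x y z : x <= y < z ->
    knuth_step (u ++ [:: x; z; y] ++ v) (u ++ [:: z; x; y] ++ v)
| KnuthYXZ u v x y z : x < y <= z ->
    knuth_step (u ++ [:: y; x; z] ++ v) (u ++ [:: y; z; x] ++ v).

Definition knuth_equiv : seq nat -> seq nat -> Prop :=
  clos_refl_sym_trans (seq nat) knuth_step.

(* The reading word to which these Knuth relations apply lists the rows from
   left to right, starting from the bottom row: it is the reversal of w(T). *)
Definition reading_word (T : tableau) : seq nat := rev (rrword T).

(* The jeu de taquin rectification of [X], as the unique semistandard Young
   tableau whose reading word is Knuth equivalent to that of [X]. *)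
Definition rect (X : tableau) : tableau :=
  xget [::] [set R : tableau |
    [/\ is_part (shape R), semistandard (shape R) [::] R
      & knuth_equiv (reading_word X) (reading_word R)]].

(* Rotation by 180 degrees in the smallest rectangle containing [T], together
   with the complementation x |-> m + 1 - x of the entries. *)
Definition rotate_compl (m : nat) (T : tableau) : tableau :=
  [seq nseq (size (trow T 1) - size r) 0 ++ rev [seq m.+1 - x | x <- r]
  | r <- rev T].

Definition schutzenberger (n : nat) (T : tableau) : tableau :=
  rect (rotate_compl n.*2 T).

Definition kwon (n : nat) (T : tableau) : Prop :=
  forall i, 1 <= i <= n -> forall x, x \in trow T i -> (i.*2).-1 <= x.

(* LRK^nu_{lam,mu}. *)
Definition LRK (n : nat) (nu lam mu : seq nat) : set tableau :=
  [set T | LRdom n nu lam mu T /\ kwon n (schutzenberger n T)].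

(** * The map U *)

(* h_{i,j}, for 0 <= j <= i <= m. *)
Definition phi (mu : seq nat) (R : tableau) (i j : nat) : nat :=
  \sum_(1 <= k < j.+1) count (geq i) (trow R k) + \sum_(1 <= k < i.+1) part mu k.

(* For h = phi mu R the subtraction is exact: phi mu R i j increases with i. *)
Definition Phat (m : nat) (h : nat -> nat -> nat) (i k : nat) : nat :=
  h (m - i + k) (m - i) - h (m - i + k - 1) (m - i).

(* The r-th part of Q_i, i.e. K - (P_i)_{m+1-r} where (P_i)_j = 0 for j > i. *)
Definition contre_part (m : nat) (P : nat -> nat -> nat) (i r : nat) : nat :=
  P m 1 - (if m.+1 - r <= i then P i (m.+1 - r) else 0).

(* Row r of C(P) has (Q_m)_r zeros, then (Q_{m-i})_r - (Q_{m-i+1})_r entries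
   equal to i, for i = 1, ..., m. *)
Definition contretableau (m : nat) (P : nat -> nat -> nat) : tableau :=
  [seq nseq (contre_part m P m r) 0 ++
       flatten [seq nseq (contre_part m P (m - i) r
                          - contre_part m P (m - i + 1) r) i | i <- iota 1 m]
  | r <- iota 1 m].

Definition Umap (n : nat) (mu : seq nat) (R : tableau) : tableau :=
  rect (contretableau n.*2 (Phat n.*2 (phi mu R))).

(** * Unions over all even partitions *)

Definition even_partitions : set (seq nat) :=
  [set lam | is_part lam /\ even_part lam].

Definition LRSeven (n : nat) (nu mu : seq nat) : set tableau :=
  \bigcup_(lam in even_partitions) LRS n nu mu lam.

Definition LRKeven (n : nat) (nu mu : seq nat) : set tableau :=
  \bigcup_(lam in even_partitions) LRK n nu lam mu.

(* Main.v *)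
(** Let m = 2n.  For T in LR(nu/mu, lambda), let nu^(j) be the shape of the entries
    <= j of T.  The pattern Phat (phi (c T)) has rows (nu^(j)_(j+1), nu^(j)_(j+2), ...),
    j = m, ..., 0, so it is the Gelfand-Tsetlin pattern of a semistandard tableau V of
    shape mu, and the contretableau is the rotated complement of V; hence
    U (c T) = S(V), where S is the Schützenberger involution, and S (U (c T)) = V.

    Counting letters row by row, the word of the rotated complement of V is
    lambda-dominant of weight nu - lambda if and only if T is Yamanouchi of weight
    lambda.  As dominance and weight are invariant under the Knuth relations, U o c is
    a bijection as soon as S is a shape-preserving involution.  This follows from the
    existence (row insertion) and uniqueness of the semistandard tableau in a Knuth
    class; uniqueness and preservation of shapes come from Greene's invariants,
    applied to the subwords of letters <= a.

    Finally the Kwon property of V says that nu^(2q) has at most n + q rows for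
    1 <= q <= n, and this is the Sundaram property of T: if an entry 2i+1 lay too low,
    it would lie in the last row containing entries 2i+1 or 2i+2, and since these
    have the same multiplicity, the Yamanouchi condition would fail there. *)

From Stdlib Require Import Relation_Operators.
Require Import Defs.
From mathcomp Require Import all_boot zify.
From mathcomp Require Import boolp classical_sets functions.

Set Implicit Arguments.
Unset Strict Implicit.
Unset Printing Implicit Defensive.

Local Open Scope nat_scope.

(** * Knuth equivalence *)

(** The effect on reading words of rotating a tableau by 180 degrees and complementing its entries
    in [1, ..., m]. *)
Definition revcompl (m : nat) (w : seq nat) : seq nat :=
  rev [seq m.+1 - x | x <- w].

Lemma knuth_refl w : knuth_equiv w w.
Proof. exact: rst_refl. Qed.

Lemma knuth_sym u v : knuth_equiv u v -> knuth_equiv v u.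
Proof. exact: rst_sym. Qed.

Lemma knuth_trans v u w :
  knuth_equiv u v -> knuth_equiv v w -> knuth_equiv u w.
Proof. exact: rst_trans. Qed.

Lemma knuth_xzy x y z : x <= y < z -> knuth_equiv [:: x; z; y] [:: z; x; y].
Proof. by move=> h; apply: rst_step; exact: (KnuthXZY [::] [::] h). Qed.

Lemma knuth_yxz x y z : x < y <= z -> knuth_equiv [:: y; x; z] [:: y; z; x].
Proof. by move=> h; apply: rst_step; exact: (KnuthYXZ [::] [::] h). Qed.

Lemma knuth_cat u v p s :
  knuth_equiv u v -> knuth_equiv (p ++ u ++ s) (p ++ v ++ s).
Proof.
elim=> {u v} [_ _ [u v x y z h|u v x y z h]|u|u v _ IH|u w v _ IH1 _ IH2].
- rewrite -!(catA _ _ s) (catA p) [X in knuth_equiv _ X](catA p).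
  by apply: rst_step; exact: KnuthXZY.
- rewrite -!(catA _ _ s) (catA p) [X in knuth_equiv _ X](catA p).
  by apply: rst_step; exact: KnuthYXZ.
- exact: knuth_refl.
- exact: knuth_sym.
- exact: knuth_trans IH1 IH2.
Qed.

Lemma knuth_catl p u v : knuth_equiv u v -> knuth_equiv (p ++ u) (p ++ v).
Proof. by move=> h; have := knuth_cat p [::] h; rewrite !cats0. Qed.

Lemma knuth_catr s u v : knuth_equiv u v -> knuth_equiv (u ++ s) (v ++ s).
Proof. exact: (@knuth_cat u v [::] s). Qed.

Lemma knuth_invariant (P : seq nat -> Prop) :
  (forall u v x y z, x <= y < z ->
     P (u ++ [:: x; z; y] ++ v) <-> P (u ++ [:: z; x; y] ++ v)) ->
  (forall u v x y z, x < y <= z ->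
     P (u ++ [:: y; x; z] ++ v) <-> P (u ++ [:: y; z; x] ++ v)) ->
  forall u v, knuth_equiv u v -> P u <-> P v.
Proof.
move=> h1 h2 u v; elim=> {u v}[_ _ [u v x y z h|u v x y z h]|u|u v _ IH|u w v _ IH1 _ IH2].
- exact: h1.
- exact: h2.
- by [].
- by split=> /IH.
- by rewrite IH1.
Qed.

Lemma knuth_perm u v : knuth_equiv u v -> perm_eq u v.
Proof.
move=> h; apply/(knuth_invariant _ _ (P := perm_eq u) h); last exact: perm_refl.
- move=> p s x y z _; suff /permPr-> : perm_eq (p ++ [:: x; z; y] ++ s)
    (p ++ [:: z; x; y] ++ s) by [].
  by rewrite perm_cat2l perm_cat2r (perm_catCA [:: x] [:: z] [:: y]).
- move=> p s x y z _; suff /permPr-> : perm_eq (p ++ [:: y; x; z] ++ s)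
    (p ++ [:: y; z; x] ++ s) by [].
  by rewrite perm_cat2l perm_cat2r (perm_cat2l [:: y]) (perm_catC [:: x] [:: z]).
Qed.

(** [z] is the largest letter of both relations: if it survives the filter, so do [x] and [y]; if it
    is dropped, the two sides become equal. *)
Lemma knuth_filter a u v : knuth_equiv u v ->
  knuth_equiv [seq x <- u | x <= a] [seq x <- v | x <= a].
Proof.
elim=> {u v}[_ _ [u v x y z /andP[h1 h2]|u v x y z /andP[h1 h2]]|u|u v _ IH|u w v _ IH1 _ IH2].
- rewrite !filter_cat; apply: knuth_cat => /=.
  case: (leqP z a) => za; last exact: knuth_refl.
  have -> : x <= a by lia.
  have -> : y <= a by lia.
  by apply: knuth_xzy; rewrite h1.
- rewrite !filter_cat; apply: knuth_cat => /=.
  case: (leqP z a) => za; last exact: knuth_refl.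
  have -> : x <= a by lia.
  have -> : y <= a by lia.
  by apply: knuth_yxz; rewrite h1.
- exact: knuth_refl.
- exact: knuth_sym.
- exact: knuth_trans IH1 IH2.
Qed.

Lemma revcompl_cat m u v : revcompl m (u ++ v) = revcompl m v ++ revcompl m u.
Proof. by rewrite /revcompl map_cat rev_cat. Qed.

(** Reversal with complementation exchanges the two Knuth relations; the bound [m] on the letters
    keeps the truncated subtraction strictly decreasing. *)
Lemma knuth_revcompl m u v : all (geq m) u -> knuth_equiv u v ->
  knuth_equiv (revcompl m u) (revcompl m v).
Proof.
move=> + h; elim: h => {u v}[_ _ [u v x y z h|u v x y z h]|u|u v k IH|u w v k1 IH1 _ IH2].
- rewrite !all_cat => /and3P[_ /and4P[hx hz hy _] _].
  rewrite /= in hx hy hz.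
  rewrite !(revcompl_cat m u); apply: knuth_catr.
  rewrite (revcompl_cat m [:: x; z; y]) (revcompl_cat m [:: z; x; y]); apply: knuth_catl.
  by apply: knuth_yxz; lia.
- rewrite !all_cat => /and3P[_ /and4P[hx hz hy _] _].
  rewrite /= in hx hy hz.
  rewrite !(revcompl_cat m u); apply: knuth_catr.
  rewrite (revcompl_cat m [:: y; x; z]) (revcompl_cat m [:: y; z; x]); apply: knuth_catl.
  by apply: knuth_xzy; lia.
- by move=> _; exact: knuth_refl.
- by rewrite -(perm_all _ (knuth_perm k)) => /IH/knuth_sym.
- move=> hu; apply: knuth_trans (IH1 hu) (IH2 _).
  by rewrite -(perm_all _ (knuth_perm k1)).
Qed.

Lemma revcomplK m w : all (geq m) w -> revcompl m (revcompl m w) = w.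
Proof.
move=> /allP h; rewrite /revcompl map_rev revK -map_comp.
rewrite -[RHS]map_id; apply/eq_in_map => x /h /=; lia.
Qed.

Lemma revcompl_le m w : all (leq 1) w -> all (geq m) (revcompl m w).
Proof.
by move=> /allP h; rewrite all_rev; apply/allP => _ /mapP[x /h hx ->] /=; lia.
Qed.

Lemma revcompl_gt0 m w : all (geq m) w -> all (leq 1) (revcompl m w).
Proof.
by move=> /allP h; rewrite all_rev; apply/allP => _ /mapP[x /h /= hx ->]; lia.
Qed.

(** * Invariance of dominance under the Knuth relations *)

Definition dom_word (lam : seq nat) (w : seq nat) : Prop :=
  forall k i, 1 <= i ->
    part lam i.+1 + count_mem i.+1 (take k w) <= part lam i + count_mem i (take k w).

Lemma take_rev_cat {T : Type} (P : seq T -> Prop) (w : seq T) :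
  (forall k, P (take k (rev w))) <-> (forall u v, w = u ++ v -> P (rev v)).
Proof.
split=> [h u v E|h k].
  by have := h (size (rev v)); rewrite E rev_cat take_size_cat.
by rewrite take_rev; apply: (h (take (size w - k) w)); rewrite cat_take_drop.
Qed.

(** The Knuth relations act on the reading word, the reversal of the row word. Prefixes thus become
    suffixes, and letters can be prepended one at a time. *)
Definition dom_suffix (lam : seq nat) (w : seq nat) : Prop :=
  forall i, 1 <= i -> forall u v, w = u ++ v ->
    part lam i.+1 + count_mem i.+1 v <= part lam i + count_mem i v.

Lemma dom_word_rev lam w : dom_word lam (rev w) <-> dom_suffix lam w.
Proof.
split=> [h i i1|h k i i1].
  have := take_rev_cat (fun s => part lam i.+1 + count_mem i.+1 s <= part lam i + count_mem i s) w.
  by case=> [hh _] u v E; have := hh (fun k => h k i i1) u v E; rewrite !count_rev.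
have := take_rev_cat (fun s => part lam i.+1 + count_mem i.+1 s <= part lam i + count_mem i s) w.
by case=> [_ hh]; apply: hh => u v /(h i i1); rewrite !count_rev.
Qed.

Lemma dom_suffix_cons lam x w : dom_suffix lam (x :: w) <->
  dom_suffix lam w /\ forall i, 1 <= i ->
    part lam i.+1 + count_mem i.+1 (x :: w) <= part lam i + count_mem i (x :: w).
Proof.
split=> [h|[h1 h2] i i1 [|y u] v].
- split=> [i i1 u v E|i i1]; first by apply: (h i i1 (x :: u)); rewrite E.
  exact: (h i i1 [::]).
- by move=> /= <-; exact: h2.
- by case=> _ /h1; apply.
Qed.

Lemma dom_suffix_congr lam p u v : perm_eq u v ->
  (dom_suffix lam u <-> dom_suffix lam v) ->
  (dom_suffix lam (p ++ u) <-> dom_suffix lam (p ++ v)).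
Proof.
move=> /permP e h; elim: p => [//|x p IH].
rewrite !cat_cons !dom_suffix_cons IH.
split=> -[h1 h2]; split=> // i /h2; rewrite /= !count_cat !e //.
Qed.

(** [x z y] and [z x y] differ in one suffix, [x y] against [z y], which can fail only by the new
    letter [i.+1]. If [x = i.+1], then [z] is not counted and the full word gives the bound. If
    [z = i.+1], either [x] is not counted, or [x = y = i] and [y] compensates [z]. *)
Lemma dom_xzy i x y z l l' c c' : x <= y < z ->
  l' + c' <= l + c ->
  l' + ((y == i.+1) + c') <= l + ((y == i) + c) ->
  (l' + ((x == i.+1) + ((z == i.+1) + ((y == i.+1) + c'))) <=
   l + ((x == i) + ((z == i) + ((y == i) + c))) ->
   l' + ((x == i.+1) + ((y == i.+1) + c')) <= l + ((x == i) + ((y == i) + c)))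
  /\
  (l' + ((z == i.+1) + ((x == i.+1) + ((y == i.+1) + c'))) <=
   l + ((z == i) + ((x == i) + ((y == i) + c))) ->
   l' + ((z == i.+1) + ((y == i.+1) + c')) <= l + ((z == i) + ((y == i) + c))).
Proof.
move=> h1 h2 h3; split; move: h1 h2 h3.
  by case: (eqVneq x i.+1) => [->|_]; lia.
by case: (eqVneq z i.+1) => [->|_]; first case: (eqVneq x i) => [->|_]; lia.
Qed.

(** The differing suffixes are [x] and [z]. The critical case is [z = i.+1], [x = i], which forces
    [y = i.+1]: the full word then has two letters [i.+1] against one [i], which leaves room for [z]
    alone. *)
Lemma dom_yxz i x y z l l' c c' : x < y <= z ->
  l' + c' <= l + c ->
  (l' + ((x == i.+1) + ((z == i.+1) + c')) <= l + ((x == i) + ((z == i) + c)) ->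
   l' + ((x == i.+1) + c') <= l + ((x == i) + c))
  /\
  (l' + ((y == i.+1) + ((z == i.+1) + ((x == i.+1) + c'))) <=
   l + ((y == i) + ((z == i) + ((x == i) + c))) ->
   l' + ((z == i.+1) + ((x == i.+1) + c')) <= l + ((z == i) + ((x == i) + c)) ->
   l' + ((z == i.+1) + c') <= l + ((z == i) + c)).
Proof.
move=> h1 h2; split; move: h1 h2.
  by case: (eqVneq x i.+1) => [->|]; lia.
case: (eqVneq z i.+1) => [->|]; last lia.
by case: (eqVneq x i) => [->|]; first case: (eqVneq y i.+1) => [->|]; lia.
Qed.

Lemma knuth_dom lam u v : knuth_equiv u v ->
  dom_word lam (rev u) <-> dom_word lam (rev v).
Proof.
move=> h; rewrite !dom_word_rev; move: h; apply: knuth_invariant.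
- move=> p s x y z hx; apply: dom_suffix_congr.
    by apply/permP => a /=; rewrite addnCA.
  rewrite !dom_suffix_cons; split=> -[[[h1 h2] h3] h4]; (split; [split|]) => //.
  + move=> i i1.
    exact: (dom_xzy hx (h1 i i1 [::] s erefl) (h2 i i1)).1 (h4 i i1).
  + by move=> i /h4; rewrite /= [(x == _) + _]addnCA [(x == i) + _]addnCA.
  + move=> i i1.
    exact: (dom_xzy hx (h1 i i1 [::] s erefl) (h2 i i1)).2 (h4 i i1).
  + by move=> i /h4; rewrite /= [(z == _) + _]addnCA [(z == i) + _]addnCA.
- move=> p s x y z hx; apply: dom_suffix_congr.
    by apply/permP => a /=; congr (_ + _); rewrite addnCA.
  have sw i : part lam i.+1 + count_mem i.+1 [:: x, z & s] <=
      part lam i + count_mem i [:: x, z & s] <->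
    part lam i.+1 + count_mem i.+1 [:: z, x & s] <=
      part lam i + count_mem i [:: z, x & s].
    by rewrite /= [(x == _) + _]addnCA [(x == i) + _]addnCA.
  rewrite !dom_suffix_cons; split=> -[[[h1 h2] h3] h4]; (split; [split; [split|]|]) => //.
  + move=> i i1.
    have [+ _] := dom_yxz i hx (h1 i i1 [::] s erefl); apply; exact: h3.
  + by move=> i i1; apply/sw/h3.
  + by move=> i /h4; rewrite /= [(x == _) + _]addnCA [(x == i) + _]addnCA.
  + move=> i i1.
    have [_ +] := dom_yxz i hx (h1 i i1 [::] s erefl); apply; [exact: h4|exact: h3].
  + by move=> i i1; apply/sw/h3.
  + by move=> i /h4; rewrite /= [(z == _) + _]addnCA [(z == i) + _]addnCA.
Qed.

(** * Greene's invariants *)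

Definition upd {I : eqType} (s : I -> nat) (j : I) (x : nat) : I -> nat :=
  fun l => if l == j then x else s l.

(* [n] letters of [w] can be distributed into weakly increasing subwords indexed by
   [I], the one of index [j] having its letters between [s j] and [t j]: for [s] low,
   [t] high and [#|I| = k], the largest such [n] is the [k]-th Greene invariant. *)
Fixpoint run (I : finType) (w : seq nat) (s t : I -> nat) (n : nat) : Prop :=
  if w is x :: w' then
    run w' s t n \/
    exists j n', [/\ n = n'.+1, s j <= x & run w' (upd s j x) t n']
  else n = 0 /\ forall j, s j <= t j.

Section Run.
Variable I : finType.
Implicit Types (s t : I -> nat) (w : seq nat).

Lemma run_mono w s s' t t' n : (forall j, s' j <= s j) -> (forall j, t j <= t' j) ->
  run w s t n -> run w s' t' n.
Proof.
move=> + tt; elim: w s s' n => [|x w IH] s s' n ss /=.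
  by case=> -> st; split=> // j; apply: leq_trans (tt j); apply: leq_trans (st j).
case=> [/(IH _ _ _ ss)|[j [n' [-> sj /IH h]]]]; first by left.
right; exists j, n'; split=> //; first exact: leq_trans (ss j) sj.
by apply: h => l; rewrite /upd; case: eqP.
Qed.

Lemma run_reindex (f g : I -> I) w s t n : cancel f g -> cancel g f ->
  run w s t n -> run w (s \o f) (t \o f) n.
Proof.
move=> fg gf; elim: w s n => [|x w IH] s n /=.
  by case=> -> st; split=> // j; exact: st.
case=> [/IH|[j [n' [-> sj /IH h]]]]; first by left.
right; exists (g j), n'; split=> //=; first by rewrite gf.
apply: run_mono h => // l; rewrite /upd /=.
by case: eqP => [->|/eqP ne]; rewrite ?gf ?eqxx // -(can_eq gf) fg (negbTE ne).
Qed.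

Lemma run_cat u v s t n : run (u ++ v) s t n <->
  exists r a b, [/\ n = a + b, run u s r a & run v r t b].
Proof.
elim: u s n => [|x u IH] s n /=.
  split=> [h|[r [a [b [-> [-> sr] h]]]]]; last exact: run_mono h.
  by exists s, 0, n; split.
rewrite IH; split.
  case=> [[r [a [b [-> h1 h2]]]]|[j [n' [-> sj /IH[r [a [b [-> h1 h2]]]]]]]].
    by exists r, a, b; split=> //; left.
  exists r, a.+1, b; split=> //; right; by exists j, a.
move=> [r [a [b [-> [h1|[j [n' [-> sj h1]]]] h2]]]]; first by left; exists r, a, b.
right; exists j, (n' + b); split=> //; apply/IH; by exists r, n', b.
Qed.

(** [run] peels off the first letter. The last letter is peeled off symmetrically, by lowering the
    upper bound of its slot; this is what reversal of words needs. *)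
Lemma run_rcons w x s t n : run (rcons w x) s t n <->
  run w s t n \/ exists j n', [/\ n = n'.+1, x <= t j & run w s (upd t j x) n'].
Proof.
have U s' j : (s' j <= x /\ forall l, upd s' j x l <= t l) <->
    (x <= t j /\ forall l, s' l <= upd t j x l).
  rewrite /upd; split=> -[h1 h2]; split=> [|l].
  - by have := h2 j; rewrite eqxx.
  - by case: eqP => [->//|ne]; have := h2 l; case: eqP.
  - by have := h2 j; rewrite eqxx.
  - by case: eqP => [->//|ne]; have := h2 l; case: eqP.
elim: w s n => [|y w IH] s n /=.
  split=> -[]; [by left| |by left|].
    move=> [j [n' [-> h1 [-> h2]]]]; right; exists j, 0.
    by have [] := (U s j).1 (conj h1 h2).
  move=> [j [n' [-> h1 [-> h2]]]]; right; exists j, 0.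
  by have [] := (U s j).2 (conj h1 h2).
rewrite IH; split.
  case=> [[h|[j [n' [-> h1 h2]]]]|[j [n' [-> sj /IH]]]].
  - by left; left.
  - by right; exists j, n'; split=> //; left.
  - case=> [h|[l [b [-> h1 h2]]]]; first by left; right; exists j, n'.
    by right; exists l, b.+1; split=> //; right; exists j, b.
case=> [[h|[j [n' [-> h1 h2]]]]|[j [n' [-> h1]]]].
- by left; left.
- by right; exists j, n'; split=> //; apply/IH; left.
- case=> [h|[l [b [-> h2 h3]]]]; first by left; right; exists j, n'.
  by right; exists l, b.+1; split=> //; apply/IH; right; exists j, b.
Qed.

(** Increasing subwords stay increasing under reversal with complementation, while lower and upper
    bounds trade places. *)
Lemma run_revcompl m w s t n : run w s t n ->
  run (revcompl m w) (fun j => m.+1 - t j) (fun j => m.+1 - s j) n.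
Proof.
elim: w s n => [|x w IH] s n /=.
  by case=> -> st; split=> // j; apply: leq_sub2l.
rewrite /revcompl /= rev_cons run_rcons.
case=> [/IH|[j [n' [-> sj /IH h]]]]; first by left.
right; exists j, n'; split=> //; first exact: leq_sub2l.
by apply: run_mono h => // l; rewrite /upd; case: eqP.
Qed.

Let swap (i j l : I) := if l == i then j else if l == j then i else l.

Lemma swapK i j : cancel (swap i j) (swap i j).
Proof.
move=> l; rewrite /swap; case: (eqVneq l i) => [->|li].
  by rewrite eqxx; case: eqVneq.
by case: (eqVneq l j) => [->|lj]; rewrite ?eqxx // (negbTE li) (negbTE lj).
Qed.

(** * Invariance of [run] under the Knuth relations *)

Section Knuth.
Variable M : nat.
Let cM := fun _ : I => M.

Lemma run_congr p u v : (forall s n, run u s cM n -> run v s cM n) ->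
  forall s n, run (p ++ u) s cM n -> run (p ++ v) s cM n.
Proof.
move=> h; elim: p => [//|x p IH] s n /=.
by case=> [/IH|[j [n' [-> sj /IH h']]]]; [left|right; exists j, n'].
Qed.

(** All slots have the same upper bound [M], so two subwords may exchange their continuations. *)
Lemma run_swap (i j : I) w s s' n : s' j <= s i -> s' i <= s j ->
  (forall l, l != i -> l != j -> s' l <= s l) ->
  run w s cM n -> run w s' cM n.
Proof.
move=> hi hj h /(run_reindex (swapK i j) (swapK i j)).
apply: run_mono => // l; rewrite /= /swap.
case: (eqVneq l i) => [->//|li]; case: (eqVneq l j) => [->//|lj]; exact: h.
Qed.

Lemma run_comm (x z : nat) v s n i j : i != j -> s i <= x -> s j <= z ->
  run v (upd (upd s i x) j z) cM n ->
  run [:: z, x & v] s cM n.+2.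
Proof.
move=> ij si sj h /=; right; exists j, n.+1; split=> //; right; exists i, n.
split=> //; first by rewrite /upd (negbTE ij).
by apply: run_mono h => // l; rewrite /upd; do !case: eqP => //; move=> -> E; rewrite E eqxx in ij.
Qed.

Lemma run_xzy x y z v s n : x <= y < z ->
  run [:: x, z, y & v] s cM n -> run [:: z, x, y & v] s cM n.
Proof.
move=> xyz [|[i [n' [-> six]]]].
  case=> [h|[j [n' [-> sj h]]]]; first by left; left.
  by right; exists j, n'; split=> //; left.
case=> [h|[j [n'' [-> sj h]]]]; first by left; right; exists i, n'.
have [E|ij] := eqVneq i j; last first.
  apply: (@run_comm x z (y :: v) s n'' i j ij six _ h).
  by move: sj; rewrite /upd eq_sym (negbTE ij).
(* Slot [i] takes both [x] and [z], which the order [z x] forbids. If [y] is skipped, [i] takes [y]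
   in place of [z]. If another slot [j] takes [y], then [i] takes [x y], [j] takes [z], and the two
   continuations are exchanged. *)
subst j; case: h => [h|[j [n3 [-> sjy h]]]].
  left; right; exists i, n''.+1; split=> //; right; exists i, n''.
  split=> //; first by rewrite /upd eqxx; lia.
  by apply: run_mono h => // l; rewrite /upd; case: eqP; lia.
have ij : i != j.
  by apply: contraTneq sjy => <-; rewrite /upd eqxx; lia.
have sjy' : s j <= y by move: sjy; rewrite /upd eq_sym (negbTE ij).
apply: (@run_comm x z (y :: v) s n3.+1 i j) => //; first by lia.
right; exists i, n3; split=> //.
  by rewrite /upd eqxx (negbTE ij); lia.
have ji : j != i by rewrite eq_sym.
apply: (run_swap (i := i) (j := j)) h => [||l li lj].
- by rewrite /upd ?eqxx ?(negbTE ij) ?(negbTE ji) ?eqxx.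
- by rewrite /upd ?eqxx ?(negbTE ij) ?(negbTE ji) ?eqxx; lia.
- by rewrite /upd (negbTE li) (negbTE lj).
Qed.

(** No slot can take [z] and then [x < z], so the two letters go to distinct slots and may be read
    in either order. *)
Lemma run_zxy x y z v s n : x <= y < z ->
  run [:: z, x, y & v] s cM n -> run [:: x, z, y & v] s cM n.
Proof.
move=> xyz [|[i [n' [-> six]]]].
  case=> [h|[j [n' [-> sj h]]]]; first by left; left.
  by right; exists j, n'; split=> //; left.
case=> [h|[j [n'' [-> sj h]]]]; first by left; right; exists i, n'.
have ij : i != j.
  by apply: contraTneq sj => <-; rewrite /upd eqxx; lia.
apply: (@run_comm z x (y :: v) s n'' i j ij six _ h).
by move: sj; rewrite /upd eq_sym (negbTE ij).
Qed.

Lemma run_yxz x y z v s n : x < y <= z ->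
  run [:: y, x, z & v] s cM n -> run [:: y, z, x & v] s cM n.
Proof.
move=> xyz [|[j [n' [-> sj]]]].
  case=> [h|[i [n' [-> six h]]]].
    left; case: h => [h|[j [n' [-> sj h]]]]; first by left; left.
    by right; exists j, n'; split=> //; left.
  case: h => [h|[j [n2 [-> sj h]]]]; first by left; left; right; exists i, n'.
  have [E|ij] := eqVneq i j; last first.
    left; apply: (@run_comm x z v s n2 i j ij six _ h).
    by move: sj; rewrite /upd eq_sym (negbTE ij).
  (* [y] is skipped and slot [i] takes [x z]: it takes [y z] instead. *)
  subst j; right; exists i, n2.+1; split=> //; first by lia.
  right; exists i, n2; split=> //; first by rewrite /upd eqxx; lia.
  by left; apply: run_mono h => // l; rewrite /upd; case: eqP.
case=> [h|[i [n2 [-> six h]]]].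
  right; exists j, n'; split=> //.
  case: h => [h|[i [n2 [-> si h]]]]; first by left; left.
  by right; exists i, n2; split=> //; left.
case: h => [h|[l [n3 [-> sl h]]]].
  by right; exists j, n2.+1; split=> //; left; right; exists i, n2.
have [E|il] := eqVneq i l; last first.
  right; exists j, n3.+2; split=> //; apply: (@run_comm x z v _ n3 i l il six _ h).
  by move: sl; rewrite {1}/upd eq_sym (negbTE il).
(* Slot [j] takes [y] and slot [i] takes [x z]: now [j] takes [y z], [i] takes [x], and the
   continuations are exchanged. *)
subst l; have ij : i != j.
  by apply: contraTneq six => ->; rewrite /upd eqxx; lia.
have si' : s i <= x by move: six; rewrite /upd (negbTE ij).
right; exists j, n3.+2; split=> //; right; exists j, n3.+1; split=> //.
  by rewrite /upd eqxx; lia.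
right; exists i, n3; split=> //; first by rewrite /upd (negbTE ij).
have ji : j != i by rewrite eq_sym.
apply: (run_swap (i := i) (j := j)) h => [||l li lj].
- by rewrite /upd ?eqxx ?(negbTE ij) ?(negbTE ji) ?eqxx.
- by rewrite /upd ?eqxx ?(negbTE ij) ?(negbTE ji) ?eqxx; lia.
- by rewrite /upd (negbTE li) (negbTE lj).
Qed.

Lemma run_yzx x y z v s n : x < y <= z ->
  run [:: y, z, x & v] s cM n -> run [:: y, x, z & v] s cM n.
Proof.
move=> xyz; apply: (@run_congr [:: y]) => {}s {}n.
case=> [|[i [n' [-> six]]]].
  case=> [h|[j [n' [-> sj h]]]]; first by left; left.
  by right; exists j, n'; split=> //; left.
case=> [h|[j [n'' [-> sj h]]]]; first by left; right; exists i, n'.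
have ij : i != j.
  by apply: contraTneq sj => <-; rewrite /upd eqxx; lia.
apply: (@run_comm z x v s n'' i j ij six _ h).
by move: sj; rewrite /upd eq_sym (negbTE ij).
Qed.

Lemma run_knuth u v s n : knuth_equiv u v -> run u s cM n <-> run v s cM n.
Proof.
move: u v; apply: (knuth_invariant (P := fun w => run w s cM n)).
- move=> u v x y z h; split; apply: run_congr => {}s {}n.
    exact: run_xzy h.
  exact: run_zxy h.
- move=> u v x y z h; split; apply: run_congr => {}s {}n.
    exact: run_yxz h.
  exact: run_yzx h.
Qed.

End Knuth.
End Run.

(** * Greene's invariants of a semistandard tableau *)

Definition read (T : tableau) : seq nat := flatten (rev T).

Lemma read_cons r T : read (r :: T) = read T ++ r.
Proof. by rewrite /read rev_cons flatten_rcons. Qed.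

(** The entries [<= a] of a weakly increasing row form an initial segment, so conditions on entries
    become conditions on counts. *)
Lemma sorted_count s a c : sorted leq s -> c < size s ->
  (nth 0 s c <= a) = (c < count (geq a) s).
Proof.
elim: s c => [//|x s IH] c /= xs cs.
have ss := path_sorted xs.
have /allP xm := order_path_min leq_trans xs.
case: (leqP x a) => [xa|ax].
  by case: c cs => [|c] cs /=; rewrite add1n // ltnS IH.
have /eqP -> : 0 + count (geq a) s == 0.
  by rewrite add0n -leqn0 leqNgt -has_count; apply/hasPn => y /xm /=; lia.
apply/negbTE; rewrite -ltnNge; apply: leq_trans ax _.
by case: c cs => [//|c] cs; apply: xm; exact: mem_nth.
Qed.

Lemma sorted_rows_lt s r : sorted leq s -> sorted leq r -> all (leq 1) s ->
  (forall a, count (geq a) s <= count (geq a.-1) r) ->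
  forall c, c < size s -> c < size r /\ nth 0 r c < nth 0 s c.
Proof.
move=> ss sr s1 h c cs.
have : c < count (geq (nth 0 s c)) s by rewrite -sorted_count.
move=> /leq_trans/(_ (h _)) cr.
have cs' : c < size r by apply: leq_trans cr (count_size _ _).
split=> //; move: cr; rewrite -sorted_count //.
have := allP s1 _ (mem_nth 0 cs) => /=; lia.
Qed.

(** Column strictness is encoded by the interlacing of the counts, as in Gelfand-Tsetlin patterns;
    it also forces the shape to decrease. *)
Definition ssyt (T : tableau) : Prop :=
  [/\ all (sorted leq) T, all (all (leq 1)) T
    & forall r a, count (geq a) (nth [::] T r.+1) <= count (geq a.-1) (nth [::] T r)].

Lemma ssyt_behead r T : ssyt (r :: T) -> ssyt T.
Proof. by case=> /= /andP[_ h1] /andP[_ h2] h3; split=> // i a; exact: (h3 i.+1). Qed.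

Lemma ssyt_row T i : ssyt T -> sorted leq (nth [::] T i) /\ all (leq 1) (nth [::] T i).
Proof.
case=> h1 h2 _; have [iT|iT] := ltnP i (size T); last by rewrite nth_default.
by split; [move/all_nthP: h1 | move/all_nthP: h2]; apply.
Qed.

Lemma ssyt_lt T i c : ssyt T -> c < size (nth [::] T i.+1) ->
  c < size (nth [::] T i) /\ nth 0 (nth [::] T i) c < nth 0 (nth [::] T i.+1) c.
Proof.
move=> hT; have [s1 p1] := ssyt_row i.+1 hT; have [s2 p2] := ssyt_row i hT.
by case: hT => _ _ h; apply: sorted_rows_lt => // a; exact: h.
Qed.

Lemma ssyt_shape T : ssyt T -> sorted geq (shape T).
Proof.
elim: T => [//|r [//|s T] IH] hT /=; apply/andP; split; last exact: IH (ssyt_behead hT).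
rewrite /= leqNgt; apply/negP => h.
by have := ssyt_lt (i := 0) hT h; rewrite /= ltnn => -[].
Qed.

Lemma run_skip (I : finType) w (s t : I -> nat) : (forall j, s j <= t j) -> run w s t 0.
Proof. by move=> h; elim: w => [//|x w IH] /=; left. Qed.

Lemma run_path (I : finType) r (s t : I -> nat) j : path leq (s j) r ->
  last (s j) r <= t j -> (forall l, l != j -> s l <= t l) -> run r s t (size r).
Proof.
elim: r s => [|x r IH] s /=.
  by move=> _ st h; split=> // l; have [->|] := eqVneq l j; [|exact: h].
move=> /andP[sx p] l h; right; exists j, (size r); split=> //; apply: IH.
- by rewrite /upd eqxx.
- by rewrite /upd eqxx.
- by move=> i ij; rewrite /upd (negbTE ij); exact: h.
Qed.

(** Lower bound in Greene's theorem: the first [k] rows are disjoint weakly increasing subwords. *)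
Lemma run_read k M T : all (sorted leq) T -> all (all (geq M)) T ->
  run (read T) (fun=> 0) (fun _ : 'I_k => M) (sumn (take k (shape T))).
Proof.
move=> hs hM.
(* For the induction, the first row goes to slot [i] and the rows below it to the next slots; the
   upper bound 0 reserves the slots before [i]. *)
suff H i : run (read T) (fun=> 0) (fun j : 'I_k => if j < i then 0 else M)
    (sumn (take (k - i) (shape T))).
  by have := H 0; rewrite subn0.
elim: T hs hM i => [|r T IH] /=; first by move=> _ _ i; rewrite /=.
move=> /andP[sr sT] /andP[Mr MT] i; rewrite read_cons; apply/run_cat.
have [ik|ik] := leqP k i.
  have -> : k - i = 0 by lia.
  rewrite take0 /=; exists (fun=> 0), 0, 0; split=> //; apply: run_skip => j //.
(* The rows below are read first and leave slot [i] at 0; it then receives the row [r]. *)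
exists (fun j : 'I_k => if j < i.+1 then 0 else M), (sumn (take (k - i.+1) (shape T))), (size r).
have -> : k - i = (k - i.+1).+1 by lia.
split=> /=; [by rewrite addnC|exact: IH|].
apply: (@run_path _ r _ _ (Ordinal ik)) => /=.
- by rewrite ltnSn; case: (r) sr.
- rewrite ltnSn ltnn; case: (r) Mr => [//|x l] /allP; apply; exact: mem_last.
- move=> l li; have {}li : l != i :> nat by apply: contra li => /eqP h; apply/eqP/val_inj.
  by case: (ltnP l i.+1); case: (ltnP l i) => //; lia.
Qed.

Section Upper.
Variables k C : nat.

(* [len c] and [top c] are the length of the part of the column [c] that was read and
   its last letter.  The letters of a column decrease, so those that are absorbed go to
   distinct slots, whose current values are all at least [top c]. *)
Definition potential (len top : nat -> nat) (s : 'I_k -> nat) :=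
  \sum_(c < C) minn (len c) #|[pred j | top c <= s j]|.

Lemma potential_le len top s len' top' s' :
  (forall c, c < C -> minn (len c) #|[pred j | top c <= s j]| <=
                      minn (len' c) #|[pred j | top' c <= s' j]|) ->
  potential len top s <= potential len' top' s'.
Proof. by move=> h; apply: leq_sum => c _; exact: h. Qed.

Lemma potential_lt c0 len top s len' top' s' : c0 < C ->
  (forall c, c < C -> minn (len c) #|[pred j | top c <= s j]| + (c == c0) <=
                      minn (len' c) #|[pred j | top' c <= s' j]|) ->
  potential len top s < potential len' top' s'.
Proof.
move=> hC h; rewrite /potential (bigD1 (Ordinal hC)) //= [X in _ < X](bigD1 (Ordinal hC)) //=.
rewrite -addSn; apply: leq_add; first by have := h c0 hC; rewrite eqxx addn1.
by apply: leq_sum => c _; apply: leq_trans (h c (ltn_ord c)); exact: leq_addr.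
Qed.

(** The letter [x] read in a column is smaller than the previous [top]. The slots counted before are
    still counted, and if [x] is absorbed, its slot passes from below the old [top] to [x] and is
    counted in addition. Raising a slot never decreases the terms of the other columns. *)
Lemma run_row_potential r c0 len top s t n : c0 + size r <= C ->
  (forall i, i < size r -> len (c0 + i) = 0 \/ nth 0 r i < top (c0 + i)) ->
  run r s t n ->
  potential len top s + n <=
  potential (fun c => len c + (c0 <= c < c0 + size r))
    (fun c => if c0 <= c < c0 + size r then nth 0 r (c - c0) else top c) t.
Proof.
elim: r c0 len top s n => [|x r IH] c0 len top s n /=.
  move=> _ _ [-> st]; rewrite addn0; apply: potential_le => c _.
  have -> : c0 <= c < c0 + 0 = false by lia.
  rewrite addn0 leq_min geq_minl /=; apply: leq_trans (geq_minr _ _) _.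
  by apply: subset_leq_card; apply/fintype.subsetP => j; rewrite !inE => /leq_trans; apply.
move=> hC h.
pose len1 c := len c + (c == c0).
pose top1 c := if c == c0 then x else top c.
have E u : potential (fun c => len1 c + (c0.+1 <= c < c0.+1 + size r))
    (fun c => if c0.+1 <= c < c0.+1 + size r then nth 0 r (c - c0.+1) else top1 c) u =
  potential (fun c => len c + (c0 <= c < c0 + (size r).+1))
    (fun c => if c0 <= c < c0 + (size r).+1 then nth 0 (x :: r) (c - c0) else top c) u.
  apply: eq_bigr => -[c cC] _ /=; rewrite /len1 /top1 -addnA.
  have -> : (c == c0) + (c0 < c < c0.+1 + size r) = (c0 <= c < c0 + (size r).+1) :> nat by lia.
  case: (eqVneq c c0) => [->|ne].
    rewrite ltnn /= leqnn subnn /=.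
    by have -> : c0 < c0 + (size r).+1 by lia.
  have -> : (c0 < c < c0.+1 + size r) = (c0 <= c < c0 + (size r).+1) by lia.
  by case: ifP => // hc; have -> : c - c0 = (c - c0.+1).+1 by lia.
have h1 i : i < size r -> len1 (c0.+1 + i) = 0 \/ nth 0 r i < top1 (c0.+1 + i).
  move=> ir; rewrite /len1 /top1; have -> : (c0.+1 + i == c0) = false by lia.
  by rewrite addn0 addSnnS; exact: h i.+1 ir.
have hC1 : c0.+1 + size r <= C by lia.
have h0 : len c0 = 0 \/ x < top c0 by have := h 0 isT; rewrite addn0.
rewrite -E => -[/(IH _ _ _ _ _ hC1 h1)|[j [n' [-> sj /(IH _ _ _ _ _ hC1 h1)]]]].
  apply: leq_trans; rewrite leq_add2r; apply: potential_le => c _.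
  rewrite /len1 /top1; case: eqP => [->|_]; last by rewrite addn0.
  case: h0 => [->|xt]; first by rewrite min0n. rewrite leq_min; apply/andP; split.
    by apply: leq_trans (geq_minl _ _) _; exact: leq_addr.
  apply: leq_trans (geq_minr _ _) _.
  apply: subset_leq_card; apply/fintype.subsetP => l; rewrite !inE; exact: leq_trans (ltnW xt).
apply: leq_trans; rewrite -addSnnS leq_add2r; apply: (@potential_lt c0); first by lia.
move=> c _; rewrite /len1 /top1; case: eqP => [->|_] /=; last first.
  rewrite !addn0 leq_min geq_minl /=; apply: leq_trans (geq_minr _ _) _.
  apply: subset_leq_card; apply/fintype.subsetP => l; rewrite !inE /upd; case: eqP => [->|//]; lia.
case: h0 => [-> |xt].
  rewrite min0n !add0n leq_min leqnn; apply/card_gt0P; exists j.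
  by rewrite inE /upd eqxx.
rewrite leq_min leq_add2r geq_minl /=.
apply: (@leq_trans (#|[pred l | top c0 <= s l]| + 1)); first by rewrite leq_add2r geq_minr.
rewrite addn1; apply: proper_card; apply/fintype.properP; split.
  apply/fintype.subsetP => l; rewrite !inE /upd; case: eqP => [->|//]; lia.
by exists j; rewrite !inE /upd ?eqxx //; lia.
Qed.

Lemma run_ssyt_potential T s t n : ssyt T -> all (geq C) (shape T) ->
  run (read T) s t n ->
  n <= potential (fun c => count (fun r => c < size r) T)
         (fun c => nth 0 (nth [::] T 0) c) t.
Proof.
elim: T t n => [|r T IH] t n hT /=; first by move=> _ [->].
move=> /andP[rC TC]; rewrite read_cons run_cat => -[u [a [b [-> h1 h2]]]].
have {h1} ha := IH _ _ (ssyt_behead hT) TC h1.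
(* Beyond the first row of [T] the columns are empty, so the default value 0 of [top] there
   contributes nothing. *)
have low c : size (nth [::] T 0) <= c -> count (fun r => c < size r) T = 0.
  have := ssyt_shape (ssyt_behead hT); case: (T) => [//|s' T'] /= p sc.
  rewrite ltnNge sc add0n; apply/eqP; rewrite -leqn0 leqNgt -has_count.
  apply/hasPn => q qT; rewrite -leqNgt; apply: leq_trans sc.
  have /allP/(_ (size q)) := order_path_min (rev_trans leq_trans) p.
  by apply; exact: map_f.
have := @run_row_potential r 0 _ _ _ _ _ _ _ h2; rewrite add0n => /(_ _ _ rC) h.
apply: (leq_trans (leq_add ha (leqnn b))); apply: leq_trans (h _ _ _) _.
  move=> i ir; have [iT|iT] := ltnP i (size (nth [::] T 0)); last by left; exact: low.
  by right; have [] := ssyt_lt (i := 0) (c := i) hT iT.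
apply: potential_le => c _ /=; rewrite subn0 addnC.
case: ltnP => // cr; rewrite low ?min0n //; apply: leq_trans cr.
by have := ssyt_shape hT; case: (T) => [//|q T'] /= /andP[].
Qed.

End Upper.

Lemma sum_ltn_ord C s : \sum_(c < C) (c < s) = minn C s.
Proof.
elim: C => [|C IH]; first by rewrite big_ord0 min0n.
by rewrite big_ord_recr /= IH; lia.
Qed.

(** The inner [count] is the length of column [c], and [minn] is the number of its boxes in the
    first [k] rows. *)
Lemma sum_min_conj k C sh : sorted geq sh ->
  \sum_(c < C) minn (count (fun s => c < s) sh) k <= sumn (take k sh).
Proof.
elim: sh k => [|s sh IH] k /= p; first by rewrite big1 // => c _; rewrite min0n.
case: k => [|k]; first by rewrite big1 // => c _; rewrite minn0.
have ps := path_sorted p.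
apply: (@leq_trans (\sum_(c < C) ((c < s) + minn (count (fun s => c < s) sh) k))).
  apply: leq_sum => c _; case: ltnP => cs /=; first by rewrite !add1n minnSS.
  rewrite !add0n (_ : count _ _ = 0) ?min0n //.
  apply/eqP; rewrite -leqn0 leqNgt -has_count; apply/hasPn => q /=.
  have /allP h := order_path_min (rev_trans leq_trans) p.
  by move=> /h /= qs; rewrite -leqNgt; exact: leq_trans cs.
by rewrite big_split /= leq_add ?IH // sum_ltn_ord geq_minr.
Qed.

(** Upper bound in Greene's theorem: with [k] slots, the final potential of a column is at most the
    smaller of its length and [k]. *)
Lemma run_ssyt_le k T s t n : ssyt T -> run (I := 'I_k) (read T) s t n ->
  n <= sumn (take k (shape T)).
Proof.
move=> hT /run_ssyt_potential => /(_ (sumn (shape T)) hT) h.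
apply: leq_trans (h _) _.
  apply/allP => x; elim: (shape T) => //= y l IH; rewrite inE => /orP[/eqP ->|/IH]; lia.
apply: leq_trans (sum_min_conj _ (sumn (shape T)) (ssyt_shape hT)).
apply: leq_sum => c _; rewrite count_map leq_min geq_minl /=.
by apply: leq_trans (geq_minr _ _) _; rewrite -[X in _ <= X]card_ord max_card.
Qed.

Lemma shape_eq (s1 s2 : seq nat) : (forall k, sumn (take k s1) = sumn (take k s2)) ->
  forall r, nth 0 s1 r = nth 0 s2 r.
Proof.
have E (s : seq nat) r : sumn (take r.+1 s) = sumn (take r s) + nth 0 s r.
  have [h|h] := ltnP r (size s); first by rewrite (take_nth 0 h) sumn_rcons.
  by rewrite nth_default // !take_oversize ?addn0 //; lia.
by move=> h r; apply/eqP; rewrite -(eqn_add2l (sumn (take r s1))) -E h h E.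
Qed.

(** By the two bounds, the largest [n] attained with [k] slots is the number of boxes in the first
    [k] rows. *)
Lemma greene_shape T1 T2 M : ssyt T1 -> ssyt T2 ->
  all (all (geq M)) T1 -> all (all (geq M)) T2 ->
  (forall k n, run (I := 'I_k) (read T1) (fun=> 0) (fun=> M) n <->
               run (I := 'I_k) (read T2) (fun=> 0) (fun=> M) n) ->
  forall r, nth 0 (shape T1) r = nth 0 (shape T2) r.
Proof.
move=> h1 h2 m1 m2 h; apply: shape_eq => k; apply/eqP; rewrite eqn_leq.
case: (h1) (h2) => s1 _ _ [s2 _ _].
by apply/andP; split; [apply: (run_ssyt_le h2); apply/h | apply: (run_ssyt_le h1); apply/h];
  exact: run_read.
Qed.

(** * Uniqueness in a Knuth class and preservation of shapes *)

Lemma leq_count_geq a b s : a <= b -> count (geq a) s <= count (geq b) s.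
Proof. by move=> ab; apply: sub_count => x /= /leq_trans; apply. Qed.

Lemma count_geqS a s : count (geq a.+1) s = count (geq a) s + count_mem a.+1 s.
Proof. by elim: s => //= x s ->; lia. Qed.

Lemma count_geq0 s : count (geq 0) s = count_mem 0 s.
Proof. by elim: s => //= x s ->; lia. Qed.

Lemma sorted_count_inj s1 s2 : sorted leq s1 -> sorted leq s2 ->
  (forall a, count (geq a) s1 = count (geq a) s2) -> s1 = s2.
Proof.
move=> h1 h2 h; apply: (sorted_eq leq_trans anti_leq) => //.
apply/allP => -[|x] _; first by rewrite /= -!count_geq0 h.
by apply/eqP/(@addnI (count (geq x) s1)); rewrite -count_geqS h count_geqS h.
Qed.

Lemma rows_inj (T1 T2 : tableau) : [::] \notin T1 -> [::] \notin T2 ->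
  (forall r, nth [::] T1 r = nth [::] T2 r) -> T1 = T2.
Proof.
move=> h1 h2 h; apply: (@eq_from_nth _ [::]) => [|i _]; last exact: h.
apply/eqP; rewrite eqn_leq; apply/andP; split; rewrite leqNgt; apply/negP => lt.
  by move: h1; rewrite -(@nth_default _ [::] T2 (size T2)) // -h mem_nth.
by move: h2; rewrite -(@nth_default _ [::] T1 (size T1)) // h mem_nth.
Qed.

Definition trunc (a : nat) (T : tableau) : tableau := [seq [seq x <- r | x <= a] | r <- T].

Lemma read_trunc a T : read (trunc a T) = [seq x <- read T | x <= a].
Proof. by rewrite /read filter_flatten map_rev. Qed.

Lemma nth_trunc a T r : nth [::] (trunc a T) r = [seq x <- nth [::] T r | x <= a].
Proof.
have [h|h] := ltnP r (size T); first by rewrite (nth_map [::]).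
by rewrite !nth_default ?size_map.
Qed.

Lemma ssyt_trunc a T : ssyt T -> ssyt (trunc a T).
Proof.
case=> h1 h2 h3; split.
- by apply/allP => _ /mapP[r /(allP h1) hr ->]; apply: sorted_filter leq_trans _ _ hr.
- apply/allP => _ /mapP[r /(allP h2)/allP hr ->]; apply/allP => x.
  by rewrite mem_filter => /andP[_ /hr].
- move=> r b; rewrite !nth_trunc !count_filter.
  apply: leq_trans (_ : count (geq (minn a b)) (nth [::] T r.+1) <= _).
    by apply: sub_count => x /=; lia.
  by apply: leq_trans (h3 _ _) _; apply: sub_count => x /=; lia.
Qed.

Lemma shape_trunc a T r : nth 0 (shape (trunc a T)) r = count (geq a) (nth [::] T r).
Proof.
rewrite -size_filter -(nth_trunc a T) /shape.
have [h|h] := ltnP r (size (trunc a T)); first by rewrite (nth_map [::]).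
by rewrite !nth_default ?size_map //; move: h; rewrite size_map.
Qed.

(** Restriction to letters [<= a] respects Knuth equivalence, so the shapes of the entries [<= a]
    agree for every [a]; these shapes determine the tableau. *)
Lemma ssyt_unique T1 T2 : ssyt T1 -> ssyt T2 -> [::] \notin T1 -> [::] \notin T2 ->
  knuth_equiv (read T1) (read T2) -> T1 = T2.
Proof.
move=> s1 s2 n1 n2 k; apply: rows_inj => // r.
apply: sorted_count_inj => [||a]; [by case: (ssyt_row r s1)|by case: (ssyt_row r s2)|].
rewrite -!shape_trunc; move: r; have tM T : all (all (geq a)) (trunc a T).
  apply/allP => _ /mapP[r _ ->]; apply/allP => x; by rewrite mem_filter => /andP[].
apply: (@greene_shape _ _ a) => //; try exact: ssyt_trunc.
by move=> j n; apply: run_knuth; rewrite !read_trunc; exact: knuth_filter.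
Qed.

Lemma all_read (p : pred nat) T : all p (read T) = all (all p) T.
Proof.
by rewrite /read -(all_rev _ T); elim: (rev T) => //= r s IH; rewrite all_cat IH.
Qed.

Lemma ssyt_revcompl_shape m T1 T2 : ssyt T1 -> ssyt T2 ->
  all (all (geq m)) T1 -> knuth_equiv (revcompl m (read T1)) (read T2) ->
  forall r, nth 0 (shape T1) r = nth 0 (shape T2) r.
Proof.
move=> s1 s2 m1 k.
have p1 : all (leq 1) (read T1) by rewrite all_read; case: s1.
have m2 : all (all (geq m)) T2.
  by rewrite -all_read -(perm_all _ (knuth_perm k)) revcompl_le.
(* The constant bounds 0 and [m.+1] are exchanged by complementation, so a run between them yields a
   run between the same bounds. *)
have R w n j : run (I := 'I_j) w (fun=> 0) (fun=> m.+1) n ->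
    run (I := 'I_j) (revcompl m w) (fun=> 0) (fun=> m.+1) n.
  by move=> /(run_revcompl m); apply: run_mono => l; rewrite ?subnn ?subn0.
have weak T : all (all (geq m)) T -> all (all (geq m.+1)) T.
  by apply: sub_all => r; apply: sub_all => x /=; lia.
apply: (@greene_shape _ _ m.+1) => // [||j n]; try exact: weak.
rewrite -(run_knuth _ _ _ k); split; first exact: R.
by move=> /R; rewrite revcomplK // all_read.
Qed.

(** * Row insertion and rectification *)

(** First half of a row insertion: [x] moves left across the entries that follow the bumped entry
    [y]. *)
Lemma knuth_bump_right x y q : x < y -> path leq y q ->
  knuth_equiv (y :: q ++ [:: x]) [:: y, x & q].
Proof.
elim: q y => [|z q IH] y xy /=; first by move=> _; exact: knuth_refl.
move=> /andP[yz p]; apply: (@knuth_trans [:: y, z, x & q]).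
  by apply: (@knuth_catl [:: y]); apply: IH => //; exact: leq_trans yz.
by apply: (@knuth_catr q [:: y; z; x] [:: y; x; z]); apply/knuth_sym/knuth_yxz; rewrite xy.
Qed.

(** Second half of a row insertion: [y] moves to the front across the entries [<= x], and is then
    ready for insertion into the row below. *)
Lemma knuth_bump_left x y p : x < y -> sorted leq p -> all (geq x) p ->
  knuth_equiv (p ++ [:: y; x]) (y :: p ++ [:: x]).
Proof.
move=> xy; elim: p => [|z p IH] /=; first by move=> _ _; exact: knuth_refl.
move=> zp /andP[zx px]; apply: (@knuth_trans (z :: y :: p ++ [:: x])).
  by apply: (@knuth_catl [:: z]); apply: IH => //; exact: path_sorted zp.
case: p zp px {IH} => [|w p] /=.
  by move=> _ _; apply: knuth_xzy; rewrite xy andbT.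
move=> /andP[zw _] /andP[wx _].
apply: (@knuth_catr (p ++ [:: x]) [:: z; y; w] [:: y; z; w]).
by apply: knuth_xzy; rewrite zw /=; exact: leq_ltn_trans xy.
Qed.

Lemma row_bump r x : sorted leq r -> ~~ all (geq x) r -> exists p y q,
  [/\ r = p ++ y :: q, x < y, all (geq x) p, all (leq y) q & sorted leq (p ++ x :: q)].
Proof.
elim: r => [//|z r IH] zr /=; have [zx|xz] /= := leqP z x.
  move=> /(IH (path_sorted zr))[p [y [q [E xy px yq s]]]].
  exists (z :: p), y, q; split=> //; rewrite ?E //= ?zx //.
  case: p E px s => [|w p] /=; first by move=> _ _ ->; rewrite zx.
  by move=> E _ ->; move: zr; rewrite E /= => /andP[->].
move=> _; exists [::], z, r; split=> //; first exact: order_path_min leq_trans zr.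
by move: zr => /=; case: (r) => //= w l /andP[zw ->]; rewrite andbT; lia.
Qed.

Lemma ssyt_cons r T : sorted leq r -> all (leq 1) r -> ssyt T ->
  (forall a, count (geq a) (nth [::] T 0) <= count (geq a.-1) r) -> ssyt (r :: T).
Proof. by move=> h1 h2 [h3 h4 h5] h; split; rewrite /= ?h1 ?h2 //; case. Qed.

(* [b] marks the values [a] for which the insertion of [x] increases the number
   of entries [<= a] of the first row: those from [x] up to the bumped entry. *)
Lemma ssyt_insert T x : ssyt T -> [::] \notin T -> 0 < x ->
  exists T' (b : pred nat), [/\ ssyt T', [::] \notin T',
    knuth_equiv (read T ++ [:: x]) (read T') &
    forall a, count (geq a) (nth [::] T' 0) = count (geq a) (nth [::] T 0) + b a /\
      (b a -> x <= a /\
         count (geq a) (nth [::] T 0) = count (geq x) (nth [::] T 0))].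
Proof.
elim: T x => [|r T IH] x hT nT x0.
  exists [:: [:: x]], (leq x); split=> //=; last by move=> a; rewrite addn0.
    by split; rewrite /= ?x0 // => -[|i] a; rewrite /= ?nth_nil.
  exact: knuth_refl.
have [sr r1] := ssyt_row 0 hT; rewrite /= in sr r1.
have col a := (let: And3 _ _ h := hT in h 0 a); rewrite /= in col.
have hT0 := ssyt_behead hT.
have nT0 : [::] \notin T by move: nT; rewrite inE negb_or => /andP[].
have [rx|/(row_bump sr)[p [y [q [E xy px yq s]]]]] := boolP (all (geq x) r).
  exists (rcons r x :: T), (leq x); split=> /=.
  - apply: ssyt_cons => //.
    + case: (r) sr rx => [//|z l] /= p rx; rewrite rcons_path p.
      exact: (allP (rx : all (geq x) (z :: l)) _ (mem_last z l)).
    + by rewrite all_rcons x0.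
    + by move=> a; apply: leq_trans (col a) _; rewrite -cats1 count_cat leq_addr.
  - by rewrite inE negb_or nT0; case: (r).
  - by rewrite !read_cons -catA cats1; exact: knuth_refl.
  - move=> a; rewrite -cats1 count_cat /= addn0; split=> // xa; split=> //.
    have /eqP -> : count (geq x) r == size r by rewrite -all_count.
    apply/eqP; rewrite -all_count; apply: sub_all rx => z /= zx; exact: leq_trans xa.
have y0 : 0 < y by lia.
have [T' [b [hT' nT' k hb]]] := IH y hT0 nT0 y0.
have r'1 : all (leq 1) (p ++ x :: q).
  by move: r1; rewrite E !all_cat /= x0 => /and3P[-> _ ->].
have Nr a : count (geq a) r = count (geq a) p + (y <= a) + count (geq a) q.
  by rewrite E count_cat /= addnA.
have Nr' a : count (geq a) (p ++ x :: q) = count (geq a) p + (x <= a) + count (geq a) q.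
  by rewrite count_cat /= addnA.
exists ((p ++ x :: q) :: T'), (fun a => (x <= a) && (a < y)); split=> /=.
- apply: ssyt_cons => // a; have [-> h] := hb a.
  case: (b a) h => [/(_ isT)[ya ->]|_] /=; last first.
    by rewrite addn0; apply: leq_trans (col a) _; rewrite Nr Nr'; lia.
  (* The next row gains an entry [<= a]. Its old count at [a] equals that at [y], which [col y]
     bounds by the entries of [r] below [y]; replacing [y] by [x] gives the new row one more of
     these. *)
  have := col y; rewrite !Nr'; have := Nr y.-1; rewrite (_ : y <= y.-1 = false); last lia.
  have := leq_count_geq p (_ : y.-1 <= a.-1); have := leq_count_geq q (_ : y.-1 <= a.-1).
  by move=> /(_ ltac:(lia)) h1 /(_ ltac:(lia)) h2; lia.
- by rewrite inE negb_or nT'; case: (p).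
- rewrite !read_cons E -!catA; apply: (@knuth_trans (read T ++ y :: p ++ x :: q)).
    apply: knuth_catl; apply: (@knuth_trans (p ++ [:: y, x & q])).
      apply: knuth_catl; apply: knuth_bump_right => //.
      by rewrite path_min_sorted //; move: sr; rewrite E => /cat_sorted2[_ /path_sorted].
    have := @knuth_catr q _ _ (@knuth_bump_left x y p xy _ px); rewrite /= -!catA; apply.
    by move: sr; rewrite E => /cat_sorted2[].
  by have := knuth_catr (p ++ x :: q) k; rewrite -catA.
- move=> a; rewrite Nr Nr'; split; first by lia.
  move=> /andP[xa ay]; split=> //; rewrite Nr.
  have sz c : x <= c -> count (geq c) p = size p.
    move=> xc; apply/eqP; rewrite -all_count; apply: sub_all px => z /= zx; exact: leq_trans xc.
  have z c : c < y -> count (geq c) q = 0.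
    move=> cy; apply/eqP; rewrite -leqn0 leqNgt -has_count; apply/hasPn => z /(allP yq) /=; lia.
  by rewrite !sz // !z //; lia.
Qed.

Lemma ssyt_exists w : all (leq 1) w ->
  exists T, [/\ ssyt T, [::] \notin T & knuth_equiv w (read T)].
Proof.
elim/last_ind: w => [_|w x IH]; first exists [::].
  by split; [split=> // r a; rewrite !nth_nil|by []|exact: knuth_refl].
rewrite all_rcons => /andP[x0 /IH[T [hT nT k]]].
have [T' [_ [hT' nT' k' _]]] := ssyt_insert hT nT x0.
exists T'; split=> //; apply: knuth_trans k'; rewrite -cats1; exact: knuth_catr.
Qed.

(** * Semistandardness in terms of row counts, and rectification *)

Lemma part_nth nu r : part nu r.+1 = nth 0 nu r. Proof. by []. Qed.

Lemma leq_eq (p q n : nat) : p <= n -> q <= n ->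
  (forall c, c < n -> (c < p) = (c < q)) -> p = q.
Proof.
move=> pn qn h; apply/eqP; rewrite eqn_leq; apply/andP; split; rewrite leqNgt; apply/negP => lt.
  by have := h q (leq_trans lt pn); rewrite lt ltnn.
by have := h p (leq_trans lt qn); rewrite lt ltnn.
Qed.

Lemma nth_shape (T : tableau) r : nth 0 (shape T) r = size (nth [::] T r).
Proof.
rewrite /shape; have [h|h] := ltnP r (size T); first by rewrite (nth_map [::]).
by rewrite !nth_default ?size_map.
Qed.

Lemma part_geq nu r : sorted geq nu -> nth 0 nu r.+1 <= nth 0 nu r.
Proof.
move=> s; have [h|h] := ltnP r.+1 (size nu); last by rewrite [nth 0 nu r.+1]nth_default.
by move: s => /(sortedP 0)/(_ r h).
Qed.

(** The inner boxes are the leading zeros of sorted rows, so entrywise conditions turn into counts.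
    Interlacing at [a = 0] says that the inner shape decreases. *)
Lemma semistandardP nu mu T : is_part nu -> is_part mu -> included mu nu ->
  semistandard nu mu T <->
  [/\ shape T = nu, all (sorted leq) T,
      forall r, count (geq 0) (nth [::] T r) = nth 0 mu r
    & forall r a, count (geq a) (nth [::] T r.+1) <= count (geq a.-1) (nth [::] T r)].
Proof.
move=> /andP[nus _] /andP[mus _] inc.
have mn r : nth 0 mu r <= nth 0 nu r by exact: (inc r.+1 isT).
split=> [[sh h1 h2 h3]|[sh srt h0 h]].
  have sz r : size (nth [::] T r) = nth 0 nu r by rewrite -nth_shape sh.
  have D r c : in_diagram nu r.+1 c.+1 = (c < size (nth [::] T r)) by rewrite sz.
  have Dm r c : in_diagram mu r.+1 c.+1 = (c < nth 0 mu r) by [].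
  have e0 r c : c < size (nth [::] T r) -> (nth 0 (nth [::] T r) c == 0) = (c < nth 0 mu r).
    by move=> hc; apply: (h1 r.+1 c.+1); rewrite D.
  have rs r : sorted leq (nth [::] T r).
    apply/(sortedP 0) => c hc; have hc' := ltnW hc.
    have [cm|cm] := ltnP c (nth 0 mu r).
      by rewrite (eqP (_ : nth 0 (nth [::] T r) c == 0)) // e0.
    by apply: (h2 r.+1 c.+1); rewrite ?D // Dm -leqNgt.
  have N0 r : count (geq 0) (nth [::] T r) = nth 0 mu r.
    apply: (@leq_eq _ _ (size (nth [::] T r))); [exact: count_size|by rewrite sz|].
    by move=> c hc; rewrite -sorted_count // leqn0 e0.
  split=> //; first by apply/(all_nthP [::]) => i _; exact: rs.
  (* [c] is the column, from 0, of the last entry [<= a] in row [r.+1]; it suffices that the box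
     above it has an entry [<= a.-1]. *)
  move=> r a; case E: (count _ (nth [::] T r.+1)) => [//|c].
  have hc : c < size (nth [::] T r.+1) by rewrite -E; exact: count_size.
  have : c < count (geq a) (nth [::] T r.+1) by rewrite E.
  have hc' : c < size (nth [::] T r).
    by rewrite sz; apply: leq_trans (part_geq _ nus); rewrite -sz.
  rewrite -!sorted_count // => la.
  have [cm|cm] := ltnP c (nth 0 mu r).
    by rewrite (eqP (_ : nth 0 (nth [::] T r) c == 0)) // e0.
  have : nth 0 (nth [::] T r) c < nth 0 (nth [::] T r.+1) c.
    by apply: (h3 r.+1 c.+1); rewrite ?D // Dm -leqNgt.
  lia.
have sz r : size (nth [::] T r) = nth 0 nu r by rewrite -nth_shape sh.
have rs r : sorted leq (nth [::] T r).
  by have [i|i] := ltnP r (size T); [move/all_nthP: srt; apply|rewrite nth_default].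
split=> //.
- move=> [//|r] [|c]; first by rewrite /in_diagram.
  rewrite /in_diagram /= => hc; rewrite -leqn0 /entry /trow /= sorted_count ?sz //.
  by rewrite h0.
- move=> [//|r] [|c]; first by rewrite /in_diagram.
  by rewrite /in_diagram /= => _ hc _; move/(sortedP 0): (rs r); apply; rewrite sz.
- move=> [//|r] [|c]; first by rewrite /in_diagram.
  rewrite /in_diagram /= /entry /trow /= -leqNgt !part_nth => hc hc' cm.
  have : c < count (geq (nth 0 (nth [::] T r.+1) c)) (nth [::] T r.+1).
    by rewrite -sorted_count // sz.
  case: (posnP (nth 0 (nth [::] T r.+1) c)) => [->|p].
    by rewrite h0 => /leq_trans/(_ (part_geq r mus)); rewrite ltnNge cm.
  move=> /leq_trans/(_ (h _ _)); rewrite -sorted_count ?sz //; lia.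
Qed.

(** Excluding empty rows makes the list of rows canonical, so that equality of tableaux is equality
    of lists. *)
Definition tabl (R : tableau) : Prop := ssyt R /\ [::] \notin R.

Lemma tablP R : tabl R <-> is_part (shape R) /\ semistandard (shape R) [::] R.
Proof.
have sh0 : (0 \notin shape R) = ([::] \notin R).
  rewrite /shape; congr (~~ _); apply/mapP/idP => [[r rR /esym/size0nil <-]|]; first by [].
  by exists [::].
have inc nu : included [::] nu by move=> i _; rewrite /part nth_nil.
have p0 : is_part [::] by [].
split=> [[h n]|[p]].
  have pR : is_part (shape R) by rewrite /is_part ssyt_shape // sh0.
  split=> //; apply/semistandardP => //; case: (h) => h1 h2 h3; split=> // r.
  have [_ /allP hr] := ssyt_row r h; rewrite nth_nil; apply/eqP.
  rewrite -leqn0 leqNgt -has_count; apply/hasPn => x /hr /=; lia.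
move=> /(semistandardP _ p p0 (inc _))[_ h1 h2 h3]; split.
  split=> //; apply/(all_nthP [::]) => r _; apply/allP => x xr.
  rewrite lt0n; apply: contraTneq xr => ->.
  have := h2 r; rewrite nth_nil count_geq0 => /eqP.
  by rewrite -leqn0 leqNgt -has_count has_pred1.
by move: p => /andP[_]; rewrite sh0.
Qed.

Lemma rrword_pos R : all (all (leq 1)) R -> rrword R = flatten [seq rev r | r <- R].
Proof.
move=> /allP h; rewrite /rrword; congr flatten; apply/eq_in_map => r /h /all_filterP <-.
by rewrite filter_id.
Qed.

Lemma rev_flatten_rev (s : seq (seq nat)) : rev (flatten [seq rev r | r <- s]) = flatten (rev s).
Proof.
elim: s => //= r s IH; by rewrite rev_cat revK IH rev_cons flatten_rcons.
Qed.

Lemma reading_word_pos R : all (all (leq 1)) R -> reading_word R = read R.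
Proof. by move=> h; rewrite /reading_word rrword_pos // rev_flatten_rev. Qed.

(** The tableau of the Knuth class of a word; [rect X] is [ptab (reading_word X)] by conversion. *)
Definition ptab (w : seq nat) : tableau :=
  xget [::] [set R : tableau |
    [/\ is_part (shape R), semistandard (shape R) [::] R
      & knuth_equiv w (reading_word R)]].

Lemma ptabP w : all (leq 1) w -> tabl (ptab w) /\ knuth_equiv w (read (ptab w)).
Proof.
move=> h; rewrite /ptab; case: xgetP => [R _ /= [p s k]|no].
  have hR : tabl R by apply/tablP.
  by split=> //; rewrite -reading_word_pos //; case: hR => -[].
have [T [hT nT k]] := ssyt_exists h.
have hT' : tabl T by [].
have /tablP[p s] := hT'.
by case: (no T); split=> //; rewrite reading_word_pos //; case: hT.
Qed.

Lemma ptab_unique w R : tabl R -> knuth_equiv w (read R) -> ptab w = R.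
Proof.
move=> [hR nR] k.
have w1 : all (leq 1) w.
  by rewrite (perm_all _ (knuth_perm k)) all_read; case: hR.
have [[h n] k'] := ptabP w1.
apply: ssyt_unique => //; apply: knuth_trans k; exact: knuth_sym.
Qed.

(** * Counting letters by rows *)

(** Recovers a weakly increasing row from its counts: for nondecreasing [f], it has [f a] entries
    [<= a] for every [a <= m]. *)
Definition mkrow (f : nat -> nat) (m : nat) : seq nat :=
  flatten [seq nseq (f a - (if a is b.+1 then f b else 0)) a | a <- iota 0 m.+1].

Lemma sorted_flatten_nseq (d : nat -> nat) b l :
  sorted leq (flatten [seq nseq (d a) a | a <- iota b l]).
Proof.
suff /andP[] : sorted leq (flatten [seq nseq (d a) a | a <- iota b l]) &&
    all (leq b) (flatten [seq nseq (d a) a | a <- iota b l]) by [].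
elim: l b => [//|l IH] b /=; have /andP[s h] := IH b.+1.
have h' : all (leq b) (flatten [seq nseq (d a) a | a <- iota b.+1 l]).
  by apply: sub_all h => x; exact: ltnW.
elim: (d b) => [|k /andP[s1 s2]] /=; first by rewrite s.
by rewrite path_min_sorted // s1 leqnn s2.
Qed.

Lemma mkrow_sorted f m : sorted leq (mkrow f m).
Proof. exact: (sorted_flatten_nseq (fun a => f a - (if a is b.+1 then f b else 0))). Qed.

Lemma mkrowS f m : mkrow f m.+1 = mkrow f m ++ nseq (f m.+1 - f m) m.+1.
Proof. by rewrite /mkrow -[m.+2]addn1 iotaD map_cat flatten_cat /= cats0. Qed.

Lemma mkrow_count f m a : (forall b, b < m -> f b <= f b.+1) ->
  count (geq a) (mkrow f m) = f (minn a m).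
Proof.
elim: m => [|m IH] h.
  by rewrite minn0 /mkrow /= cats0 subn0 count_nseq /= mul1n.
rewrite mkrowS count_cat IH; last by move=> b bm; apply: h; lia.
rewrite count_nseq /=; case: (leqP m.+1 a) => am /=.
  rewrite (minn_idPr _) ?(minn_idPr am); last by lia.
  by rewrite mul1n subnKC // h.
by rewrite (minn_idPl _) 1?(minn_idPl _) ?addn0 //; lia.
Qed.

Lemma mkrow_all f m : all (geq m) (mkrow f m).
Proof.
apply/allP => x /flattenP[_ /mapP[a + ->]]; rewrite mem_iota => ha.
by move=> /nseqP[-> _] /=; lia.
Qed.

Lemma count_geq_all a s : all (geq a) s -> count (geq a) s = size s.
Proof. by rewrite all_count => /eqP. Qed.

Lemma count_geq_max m a s : all (geq m) s -> m <= a -> count (geq a) s = size s.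
Proof.
by move=> h ma; apply: count_geq_all; apply: sub_all h => x /= /leq_trans; apply.
Qed.

Lemma mkrow_size f m : (forall b, b < m -> f b <= f b.+1) -> size (mkrow f m) = f m.
Proof.
by move=> h; rewrite -(count_geq_all (mkrow_all f m)) mkrow_count // minnn.
Qed.

Lemma count_flatten_take (p : pred nat) (T : tableau) r :
  count p (flatten (take r.+1 T)) = count p (flatten (take r T)) + count p (nth [::] T r).
Proof.
have [h|h] := ltnP r (size T).
  by rewrite (take_nth [::] h) flatten_rcons count_cat.
by rewrite nth_default // !take_oversize ?addn0 //; lia.
Qed.

Lemma count_flatten_drop (p : pred nat) (T : tableau) r :
  count p (flatten (drop r T)) = count p (nth [::] T r) + count p (flatten (drop r.+1 T)).
Proof.
have [h|h] := ltnP r (size T); first by rewrite (drop_nth [::] h) /= count_cat.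
by rewrite nth_default // !drop_oversize //; lia.
Qed.

Lemma count_flatten_rev (p : pred nat) (T : tableau) :
  count p (flatten (rev T)) = count p (flatten T).
Proof.
elim: T => //= r T IH; by rewrite rev_cons flatten_rcons !count_cat IH addnC.
Qed.

Definition posrows (T : tableau) : tableau := [seq rev [seq x <- r | 0 < x] | r <- T].

Lemma count_posrows i T : 1 <= i ->
  count_mem i (flatten (posrows T)) = count_mem i (flatten T).
Proof.
move=> i1; elim: T => //= r T IH; rewrite !count_cat IH count_rev count_filter.
by congr (_ + _); apply: eq_count => x /=; case: eqP => //= ->.
Qed.

Lemma count_rrword i T : 1 <= i -> count_mem i (rrword T) = count_mem i (flatten T).
Proof. exact: count_posrows. Qed.

(** In a weakly decreasing word the letters [i.+1] precede the letters [i], so the condition is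
    tightest after the last [i.+1], before any [i]. *)
Lemma dom_row (l l' i : nat) (b : seq nat) : sorted geq b -> l' <= l ->
  (forall k, l' + count_mem i.+1 (take k b) <= l + count_mem i (take k b)) <->
  l' + count_mem i.+1 b <= l.
Proof.
move=> sb ll; split=> [h|h k]; last first.
  apply: leq_trans (leq_addr _ _); apply: leq_trans h; rewrite leq_add2l.
  by rewrite -{2}(cat_take_drop k b) count_cat leq_addr.
have E : forall b : seq nat, sorted geq b ->
    count_mem i (take (count (leq i.+1) b) b) = 0 /\
    count_mem i.+1 (take (count (leq i.+1) b) b) = count_mem i.+1 b.
  elim=> [//|x b' IH] /= p; have /allP hp := order_path_min (rev_trans leq_trans) p.
  have [ix|xi] /= := ltnP i x.
    have [-> ->] := IH (path_sorted p); split=> //.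
    by rewrite (gtn_eqF ix).
  have c0 : count (leq i.+1) b' = 0.
    apply/eqP; rewrite -leqn0 leqNgt -has_count; apply/hasPn => y /hp /=; lia.
  rewrite c0; have -> : (x == i.+1) = false by lia.
  split=> //; symmetry; apply/eqP; rewrite -leqn0 leqNgt -has_count.
  apply/hasPn => y /hp /=; lia.
have [E1 E2] := E b sb.
by have := h (count (leq i.+1) b); rewrite E1 E2 addn0.
Qed.

Lemma dom_rows (l l' i : nat) (B : seq (seq nat)) : all (sorted geq) B -> l' <= l ->
  (forall k, l' + count_mem i.+1 (take k (flatten B)) <=
             l + count_mem i (take k (flatten B))) <->
  (forall r, l' + count_mem i.+1 (flatten (take r.+1 B)) <=
             l + count_mem i (flatten (take r B))).
Proof.
elim: B l l' => [|b B IH] l l' /=.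
  by move=> _ ll; split=> h k; rewrite !addn0.
move=> /andP[sb sB] ll; have D := dom_row i sb ll.
have step : l' + count_mem i.+1 b <= l ->
    l' + count_mem i.+1 b <= l + count_mem i b by move=> /leq_trans; apply; exact: leq_addr.
split=> h.
  have db : l' + count_mem i.+1 b <= l.
    apply/D => k; have := h (minn k (size b)).
    by rewrite takel_cat ?geq_minr // take_min take_size.
  have := IH _ _ sB (step db) => -[+ _] => /(_ _) H.
  case=> [|r]; first by rewrite take0 /= cats0 addn0.
  rewrite /= !count_cat !addnA; apply: H => k.
  have := h (size b + k); rewrite take_cat ltnNge leq_addr /= addKn.
  by rewrite !count_cat !addnA.
have db : l' + count_mem i.+1 b <= l by have := h 0; rewrite take0 /= cats0 addn0.
move=> k; rewrite take_cat; case: ltnP => kb; first exact: (D.2 db).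
rewrite !count_cat !addnA; move: (k - size b); apply/(IH _ _ sB (step db)) => r.
by have := h r.+1; rewrite /= !count_cat !addnA.
Qed.

Lemma is_part_geq lam i : is_part lam -> 1 <= i -> part lam i.+1 <= part lam i.
Proof. by case: i => // i /andP[h _] _; exact: part_geq. Qed.

Lemma dom_word_rows lam B : is_part lam -> all (sorted geq) B ->
  dom_word lam (flatten B) <->
  forall i r, 1 <= i ->
    part lam i.+1 + count_mem i.+1 (flatten (take r.+1 B)) <=
    part lam i + count_mem i (flatten (take r B)).
Proof.
move=> pl sB; split=> [h i r i1|h k i i1].
  by have [+ _] := dom_rows i sB (is_part_geq pl i1); apply=> k; exact: h.
by have [_ +] := dom_rows i sB (is_part_geq pl i1); apply=> r; exact: h.
Qed.

Lemma sorted_posrows T : all (sorted leq) T -> all (sorted geq) (posrows T).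
Proof.
move=> /allP h; apply/allP => _ /mapP[r /h hr ->]; rewrite rev_sorted.
exact: (sorted_filter leq_trans).
Qed.

Lemma yamanouchi_dom w : yamanouchi w <-> dom_word [::] w.
Proof. by split=> h k i i1; have := h k i i1; rewrite /part !nth_nil !add0n. Qed.

Lemma yamanouchi_rows T : all (sorted leq) T ->
  yamanouchi (rrword T) <->
  forall i r, 1 <= i -> count_mem i.+1 (flatten (take r.+1 T)) <=
                        count_mem i (flatten (take r T)).
Proof.
move=> sT; rewrite yamanouchi_dom (dom_word_rows _ (sorted_posrows sT)) //.
split=> h i r i1; have := h i r i1; rewrite /part !nth_nil !add0n -!map_take;
  by rewrite !(count_posrows (i := i.+1)) // (count_posrows (i := i)).
Qed.

Lemma row_tableau_count lam i r : count_mem i (flatten (take r (row_tableau lam))) =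
  if 1 <= i <= r then part lam i else 0.
Proof.
elim: r => [|r IH]; first by rewrite take0 leqn0; case: ifP => //; lia.
rewrite count_flatten_take IH; have [h|h] := ltnP r (size lam); last first.
  rewrite nth_default ?size_map ?size_iota // addn0.
  have -> : (0 < i <= r.+1) = (0 < i <= r) || (i == r.+1) by lia.
  have [->|_] := eqVneq i r.+1; last by rewrite orbF.
  by rewrite ltnn /= part_nth nth_default.
rewrite (nth_map 0) ?size_iota // nth_iota // add1n count_nseq /= eq_sym.
have [->|ne] := eqVneq i r.+1; first by rewrite ltnn leqnn mul1n.
by rewrite mul0n addn0; have -> : (0 < i <= r.+1) = (0 < i <= r) by lia.
Qed.

(** The word of [row_tableau lam] is itself Yamanouchi, of content [lam], so it only shifts the
    counts of the longer prefixes. *)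
Lemma dominantP lam R : is_part lam -> dominant lam R <-> dom_word lam (rrword R).
Proof.
move=> pl; set w := rrword (row_tableau lam).
have yw : yamanouchi w.
  apply/yamanouchi_rows.
    apply/allP => _ /mapP[i _ ->]; elim: (part lam i) => //= k IH.
    by rewrite path_min_sorted //; apply/allP => x /nseqP[->].
  move=> i r i1; rewrite !row_tableau_count /= i1 ltnS /=.
  by case: ifP => // _; exact: is_part_geq.
have cw i : 1 <= i -> count_mem i w = part lam i.
  move=> i1; rewrite count_rrword // -(take_size (row_tableau lam)) row_tableau_count i1 /=.
  rewrite size_map size_iota; case: leqP => //; case: i i1 => // i _ h.
  by rewrite part_nth nth_default.
rewrite /dominant -/w; split=> h k i i1.
  have := h (size w + k) i i1; rewrite take_cat ltnNge leq_addr /= addKn.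
  by rewrite !count_cat !cw.
rewrite take_cat; case: ltnP => kw; first exact: yw.
by rewrite !count_cat !cw //; exact: h.
Qed.

Lemma rev_revcompl_read m V :
  rev (revcompl m (read V)) = flatten (rev [seq [seq m.+1 - x | x <- r] | r <- V]).
Proof. by rewrite /revcompl revK /read map_flatten map_rev. Qed.

(** The rotated complement lists the rows of [V] from the last to the first: when row [k] brings its
    letters [i.+1], the rows read before it are those from [k.+1] on. *)
Lemma dom_word_revcompl lam m V : is_part lam -> ssyt V ->
  dom_word lam (rev (revcompl m (read V))) <->
  forall i k, 1 <= i ->
    part lam i.+1 + count (fun x => m.+1 - x == i.+1) (flatten (drop k V)) <=
    part lam i + count (fun x => m.+1 - x == i) (flatten (drop k.+1 V)).
Proof.
move=> pl hV; rewrite rev_revcompl_read dom_word_rows //; last first.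
  apply/allP => r; rewrite mem_rev => /mapP[s sV ->].
  have : sorted leq s by case: hV => /allP/(_ _ sV).
  by rewrite sorted_map; apply: sub_sorted => x y /= ?; exact: leq_sub2l.
set W := map _ V.
have c i k : count_mem i (flatten (take k (rev W))) =
    count (fun x => m.+1 - x == i) (flatten (drop (size V - k) V)).
  rewrite take_rev size_map count_flatten_rev -map_drop -map_flatten count_map.
  exact: eq_count.
split=> h i k i1.
  have [kV|kV] := ltnP k (size V); last first.
    rewrite !drop_oversize //=; last exact: ltnW.
    by rewrite !addn0; exact: is_part_geq.
  have := h i (size V - k.+1) i1; rewrite !c.
  have -> : size V - (size V - k.+1).+1 = k by lia.
  by have -> : size V - (size V - k.+1) = k.+1 by lia.
rewrite !c; have [kV|kV] := ltnP k (size V).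
  have := h i (size V - k.+1) i1.
  by have -> : (size V - k.+1).+1 = size V - k by lia.
have -> : size V - k.+1 = 0 by lia.
have -> : size V - k = 0 by lia.
apply: leq_trans (h i 0 i1) _; rewrite leq_add2l (count_flatten_drop _ _ 0).
exact: leq_addl.
Qed.

(** * The tableau of the pattern Phat *)

(** Rows are numbered from 0 here, unlike in [trow]. For a semistandard tableau of straight shape
    these numbers form its Gelfand-Tsetlin pattern. *)
Definition lecount (T : tableau) (r a : nat) : nat := count (geq a) (nth [::] T r).

(* [V] is the tableau whose Gelfand-Tsetlin pattern is Phat (phi (companion T)): the
   rows below the [j]-th of the shape of the entries [<= j] of [T]. *)
Definition linked (m : nat) (nu : seq nat) (T V : tableau) : Prop :=
  (forall j k, j <= m -> lecount T (j + k) j = lecount V k (m - j)) /\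
  (forall r j, r < j -> lecount T r j = nth 0 nu r).

Lemma lecountS T r a : lecount T r a.+1 = lecount T r a + count_mem a.+1 (nth [::] T r).
Proof. exact: count_geqS. Qed.

Lemma leq_lecount T r a b : a <= b -> lecount T r a <= lecount T r b.
Proof. exact: leq_count_geq. Qed.

Lemma lecount_default T r a : size T <= r -> lecount T r a = 0.
Proof. by move=> h; rewrite /lecount nth_default. Qed.

Lemma values_leP m T : reflect (forall r, all (geq m) (nth [::] T r)) (values_le m T).
Proof.
apply: (iffP allP) => [h r|h _ /(nthP [::])[r _ <-]]; last exact: h.
have [i|i] := ltnP r (size T); last by rewrite nth_default.
by apply: h; exact: mem_nth.
Qed.

Lemma lecount_max m T r a : values_le m T -> m <= a -> lecount T r a = size (nth [::] T r).
Proof. by move=> /values_leP/(_ r); exact: count_geq_max. Qed.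

Lemma count_mem_large m T i r : values_le m T -> m < i -> count_mem i (nth [::] T r) = 0.
Proof.
move=> /values_leP/(_ r)/allP h mi; apply/eqP; rewrite -leqn0 leqNgt -has_count.
by apply/hasPn => x /h /=; lia.
Qed.

Lemma count_flatten0 (p : pred nat) (T : tableau) :
  (forall r, count p (nth [::] T r) = 0) -> count p (flatten T) = 0.
Proof.
move=> h; rewrite -(take_size T); elim: (size T) => [|k IH]; first by rewrite take0.
by rewrite count_flatten_take IH h.
Qed.

Lemma ssyt_lecount0 V r : ssyt V -> lecount V r 0 = 0.
Proof.
move=> /(ssyt_row r)[_ /allP h]; apply/eqP; rewrite -leqn0 leqNgt -has_count.
by apply/hasPn => x /h /=; lia.
Qed.

Lemma ssyt_lecountS V r a : ssyt V -> lecount V r.+1 a <= lecount V r a.-1.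
Proof. by case=> _ _; apply. Qed.

Lemma ssyt_lecountD V r d a : ssyt V -> lecount V (r + d) a <= lecount V r (a - d).
Proof.
move=> hV; elim: d a => [|d IH] a; first by rewrite addn0 subn0.
rewrite addnS; apply: leq_trans (ssyt_lecountS _ _ hV) _.
by have -> : a - d.+1 = a.-1 - d by lia.
Qed.

Lemma compl_count m V i k : values_le m V -> 1 <= i <= m ->
  count (fun x => m.+1 - x == i) (nth [::] V k) + lecount V k (m - i) =
  lecount V k (m - i.-1).
Proof.
move=> /values_leP/(_ k)/allP hV im.
have -> : m - i.-1 = (m - i).+1 by lia.
rewrite lecountS addnC; congr (_ + _); apply: eq_in_count => x /hV /= xm.
by apply/eqP/eqP; lia.
Qed.

(* [lia] compares atoms syntactically, but instances of [count] over [nat] differ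
   in their implicit types. *)
Ltac count_lia := repeat (let c := fresh "c" in set c := count _ _; clearbody c); lia.

Section Linked.
Variables (m : nat) (nu : seq nat) (T V : tableau).
Hypotheses (Tm : size T <= m) (VT : values_le m T) (VV : values_le m V).
Hypotheses (hV : ssyt V) (lk : linked m nu T V).

Let A (i r : nat) := count_mem i (flatten (take r T)).
Let D (i k : nat) := count (fun x => m.+1 - x == i) (flatten (drop k V)).

Lemma linked_top i r : r < i -> A i r = 0.
Proof.
rewrite /A; elim: r => [|r IH] ri; first by rewrite take0.
rewrite count_flatten_take IH; last exact: ltnW.
case: i ri {IH} => // i ri.
have := lecountS T r i; rewrite (lk.2 r i ri) (lk.2 r i.+1 (ltnW ri)).
count_lia.
Qed.

(* Telescoping over the rows [>= k] of [V]; for [k = 0] it relates the weights of [V]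
   and [T], and comparing it for [i] and [i.+1] turns dominance into the Yamanouchi
   condition. *)
Lemma linked_sum i k : 1 <= i <= m ->
  D i k + count_mem i (flatten T) = lecount T (i.-1 + k) i.-1 + A i (i + k).
Proof.
move=> im; suff H d k' : size T + size V <= k' + d ->
    D i k' + count_mem i (flatten T) = lecount T (i.-1 + k') i.-1 + A i (i + k').
  by apply: (H (size T + size V)); rewrite leq_addl.
elim: d k' => [|d IH] k' hk.
  rewrite /D /A drop_oversize ?take_oversize ?lecount_default //; lia.
have := IH k'.+1; rewrite addSnnS => /(_ hk).
rewrite /D /A (count_flatten_drop _ _ k') (addnS i k') count_flatten_take.
have ii : i = i.-1.+1 by lia.
have := compl_count k' VV im; rewrite -!lk.1; [|lia|lia].
have := lecountS T (i + k') i.-1; rewrite -ii.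
have -> : i.-1 + k'.+1 = i + k' by lia.
count_lia.
Qed.

(** [linked_sum] for [i.+1] at [k] and for [i] at [k.+1] involve the same row [i + k] of [T], and
    their [lecount] terms differ by its letters [i]. Once the content of [T] is [lam], the dominance
    gap for [V] at row [k] is the Yamanouchi gap for [T] at row [i + k]. *)
Lemma linked_sum_step i k : 1 <= i -> i < m ->
  D i.+1 k + count_mem i.+1 (flatten T) + A i (i + k) =
  D i k.+1 + count_mem i (flatten T) + A i.+1 (i + k).+1.
Proof.
move=> i1 im; rewrite !linked_sum; [|lia|lia].
rewrite (_ : i.-1 + k.+1 = i + k) ?(addnS i k) /A ?(count_flatten_take (pred1 i)); last lia.
have ii : i = i.-1.+1 by lia.
have := lecountS T (i + k) i.-1; rewrite -ii /= addSn; count_lia.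
Qed.

Lemma linked_content i : 1 <= i <= m -> D i 0 + count_mem i (flatten T) = part nu i.
Proof.
move=> im; rewrite linked_sum // !addn0; case: i im => // i im /=.
rewrite /A count_flatten_take -/(A _ _) linked_top // add0n -lecountS.
by rewrite lk.2.
Qed.

Lemma count_drop_large i k : m < i -> D i k = 0.
Proof.
move=> mi; rewrite /D; apply/eqP; rewrite -leqn0 leqNgt -has_count; apply/hasPn => x.
move=> /flattenP[r /mem_drop rV xr].
have : 0 < x by case: hV => _ /allP/(_ _ rV)/allP/(_ _ xr).
lia.
Qed.

Lemma count_take_large i r : m < i -> A i r = 0.
Proof.
move=> mi; rewrite /A; apply: count_flatten0 => q.
have [h|h] := ltnP q r; last by rewrite nth_default // size_take; case: ltnP; lia.
by rewrite nth_take // (count_mem_large q VT mi).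
Qed.

Lemma count_take_total i : count_mem i (flatten T) = A i m.
Proof. by rewrite /A take_oversize. Qed.

Lemma linkedP lam : size nu <= m -> is_part lam -> all (sorted leq) T ->
  ((forall i, 1 <= i -> count_mem i (rrword T) = part lam i) /\ yamanouchi (rrword T)) <->
  ((forall i, 1 <= i -> part lam i + D i 0 = part nu i) /\
   dom_word lam (rev (revcompl m (read V)))).
Proof.
move=> num pl sT.
have C : (forall i, 1 <= i -> count_mem i (rrword T) = part lam i) <->
    (forall i, 1 <= i -> part lam i + D i 0 = part nu i).
  have nu0 i : m < i -> part nu i = 0 by case: i => // i mi; rewrite part_nth nth_default //; lia.
  split=> h i i1; have := h i i1; have [im|mi] := leqP i m.
  - rewrite count_rrword // => <-; rewrite addnC linked_content //; lia.
  - rewrite count_rrword // count_take_total count_take_large // => <-.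
    rewrite count_drop_large // nu0 //.
  - rewrite count_rrword // -linked_content; lia.
  - rewrite count_rrword // count_take_total count_take_large // count_drop_large // nu0 //; lia.
split=> -[h1 h2]; (split; first exact/C).
- have {}h1 i : 1 <= i -> count_mem i (flatten T) = part lam i.
    by move=> i1; rewrite -h1 // count_rrword.
  apply/dom_word_revcompl => // i k i1; rewrite -/(D i.+1 k) -/(D i k.+1).
  have [im|mi] := ltnP i m; last first.
    rewrite count_drop_large // -h1 // count_take_total count_take_large //; lia.
  have := (yamanouchi_rows sT).1 h2 i (i + k) i1; rewrite -/(A _ _) -/(A i _).
  have := @linked_sum_step i k i1 im; rewrite !h1 //; lia.
- have {h1} /C h1 := h1.
  have {}h1 i : 1 <= i -> count_mem i (flatten T) = part lam i.
    by move=> i1; rewrite -h1 // count_rrword.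
  apply/yamanouchi_rows => // i r i1; rewrite -/(A _ _) -/(A i _).
  have [im|mi] := ltnP i m; last by rewrite count_take_large.
  (* The first [i] rows of [T] contain no letter [i.+1], so only the rows [i + k], matched with the
     rows [k] of [V], remain. *)
  have [ri|ir] := ltnP r i; first by rewrite linked_top.
  have [k ->] : exists k, r = i + k by exists (r - i); lia.
  have := (dom_word_revcompl m pl hV).1 h2 i k i1; rewrite -/(D i.+1 k) -/(D i k.+1).
  have := @linked_sum_step i k i1 im; rewrite !h1 //; lia.
Qed.

End Linked.

(** A letter [e] in the first [r.+1] rows requires a letter [e.-1] in the first [r] rows;
    descending, one runs out of rows. *)
Lemma yamanouchi_low T e r : all (sorted leq) T -> yamanouchi (rrword T) -> r.+1 < e ->
  count_mem e (nth [::] T r) = 0.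
Proof.
move=> sT /(yamanouchi_rows sT) h re.
suff : count_mem e (flatten (take r.+1 T)) = 0 by rewrite count_flatten_take; count_lia.
elim: r e re => [|r IH] [|[|e]] // re; apply/eqP; rewrite -leqn0;
  apply: leq_trans (h _ _ _) _ => //; first by rewrite take0.
by rewrite IH //; lia.
Qed.

Lemma yamanouchi_lecount m T r j : all (sorted leq) T -> values_le m T ->
  yamanouchi (rrword T) -> r < j -> lecount T r j = size (nth [::] T r).
Proof.
move=> sT vT yT rj; rewrite -(lecount_max r vT (leq_addl j m)).
elim: m {vT} => [|m IH]; first by rewrite addn0.
by rewrite IH addnS lecountS (yamanouchi_low sT yT) ?addn0 //; lia.
Qed.

Lemma map_iota_shape (f : nat -> seq nat) nu :
  (forall r, r < size nu -> size (f r) = nth 0 nu r) ->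
  shape [seq f r | r <- iota 0 (size nu)] = nu.
Proof.
move=> h; apply: (@eq_from_nth _ 0); rewrite /shape !size_map size_iota // => r rn.
by rewrite -map_comp (nth_map 0) ?size_iota // nth_iota //= h.
Qed.

Lemma nth_map_iota (f : nat -> seq nat) s r :
  nth [::] [seq f r | r <- iota 0 s] r = if r < s then f r else [::].
Proof.
case: ltnP => h; last by rewrite nth_default // size_map size_iota.
by rewrite (nth_map 0) ?size_iota // nth_iota.
Qed.

Lemma shape_nil nu (T : tableau) : is_part nu -> shape T = nu -> [::] \notin T.
Proof.
move=> /andP[_ n0] sh; apply: contra n0 => h; rewrite -sh /shape.
by apply/mapP; exists [::].
Qed.

(** The rows of [V] are built from the counts that [linked] prescribes. The interlacing of [T] makes
    these counts nondecreasing, and the monotonicity of the counts of [T] makes [V] column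
    strict. *)
Lemma linked_exists m nu mu T : is_part nu -> is_part mu -> size nu <= m ->
  shape T = nu -> all (sorted leq) T -> values_le m T ->
  (forall r, lecount T r 0 = nth 0 mu r) ->
  (forall r a, lecount T r.+1 a <= lecount T r a.-1) -> yamanouchi (rrword T) ->
  exists V, [/\ tabl V, shape V = mu, values_le m V & linked m nu T V].
Proof.
move=> pn pm num sh sT vT h0 hS yT.
have Ts : size T = size nu by rewrite -sh size_map.
pose f k a := lecount T (m - a + k) (m - a).
have fS k b : b < m -> f k b <= f k b.+1.
  move=> bm; rewrite /f (_ : m - b = (m - b.+1).+1); last by lia.
  by rewrite addSn; exact: hS.
pose V := [seq mkrow (f k) m | k <- iota 0 (size mu)].
have fm k : f k m = nth 0 mu k by rewrite /f subnn h0.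
have fle k b : b <= m -> f k b <= f k m.
  move=> bm; have -> : b = m - (m - b) by lia.
  elim: (m - b) => [|d IH]; first by rewrite subn0.
  case: (ltnP d m) => dm; last by have -> : m - d.+1 = m - d by lia.
  apply: leq_trans IH; have := fS k (m - d.+1).
  by rewrite (_ : (m - d.+1).+1 = m - d); [apply|]; lia.
have NV k a : lecount V k a = f k (minn a m).
  rewrite /lecount nth_map_iota; case: ltnP => hk; first exact: mkrow_count (fS k).
  by have := fle k _ (geq_minr a m); rewrite fm nth_default //= leqn0 => /eqP.
have shV : shape V = mu by apply: map_iota_shape => k _; rewrite mkrow_size ?fm //; exact: fS.
have vV : values_le m V by apply/allP => _ /mapP[k _ ->]; exact: mkrow_all.
have f0 k : f k 0 = 0.
  by rewrite /f subn0 lecount_default // Ts; apply: leq_trans (leq_addr _ _).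
exists V; split=> //; last first.
  split=> [j k jm|r j rj]; first by rewrite NV /f (minn_idPl (leq_subr _ _)) subKn.
  by rewrite (yamanouchi_lecount sT vT yT rj) -sh nth_shape.
split; last exact: shape_nil pm shV.
split.
- by apply/allP => _ /mapP[k _ ->]; exact: mkrow_sorted.
- apply/(all_nthP [::]) => k _; apply/allP => x xk; rewrite lt0n; apply: contraTneq xk => ->.
  by have /eqP := NV k 0; rewrite min0n f0 /lecount count_geq0 -leqn0 leqNgt -has_count has_pred1.
- move=> k a; rewrite -/(lecount V _ _) -/(lecount V k _) !NV.
  have H b : b <= m -> f k.+1 b <= f k b.-1.
    case: b => [|b] bm; first by rewrite f0.
    rewrite /f /= addnS (_ : m - b = (m - b.+1).+1); last by lia.
    by rewrite -addSn; apply: leq_lecount; lia.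
  have [am|ma] := leqP a m.
    by rewrite (minn_idPl _) ?H //; lia.
  rewrite (minn_idPr _); last by lia.
  by apply: leq_trans (H m (leqnn m)) _; apply: fle; lia.
Qed.

(** Dominance at [k = 0], combined with the weight, bounds the entries with complement [i] in the
    first row of [V] by [part nu i - part nu i.+1]; these bounds add up from [i = m] downwards. *)
Lemma first_row_bound m nu lam V r : is_part lam -> ssyt V -> values_le m V ->
  size nu <= m ->
  (forall i, 1 <= i ->
     part lam i + count (fun x => m.+1 - x == i) (flatten V) = part nu i) ->
  dom_word lam (rev (revcompl m (read V))) -> r <= m ->
  lecount V 0 (m - r) <= nth 0 nu r.
Proof.
move=> pl hV vV num hc /(dom_word_revcompl m pl hV) hd rm.
have -> : r = m - (m - r) by lia.
elim: (m - r) (leq_subr r m) => [|d IH] dm; first by rewrite subn0 subnn ssyt_lecount0.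
have := IH (ltnW dm); set i := m - d; have im : 1 <= i <= m by lia.
have -> : m - d.+1 = i.-1 by lia.
have D0 : count (fun x => m.+1 - x == i) (flatten V) =
    count (fun x => m.+1 - x == i) (nth [::] V 0) +
    count (fun x => m.+1 - x == i) (flatten (drop 1 V)).
  by rewrite -{1}[V]drop0 count_flatten_drop.
have := compl_count 0 vV im; have := hd i 0; rewrite drop0 hc //.
have := hc i; rewrite D0; case: (i) im => // j _ /(_ isT) /=.
rewrite !part_nth; lia.
Qed.

(** Both clauses of [linked] prescribe the counts of [T]. They fit together on the diagonal [r = j]
    by [first_row_bound]. *)
Lemma linked_inverse m nu mu lam V : is_part nu -> is_part mu -> is_part lam ->
  size nu < m -> tabl V -> shape V = mu -> values_le m V ->
  (forall i, 1 <= i ->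
     part lam i + count (fun x => m.+1 - x == i) (flatten V) = part nu i) ->
  dom_word lam (rev (revcompl m (read V))) ->
  exists T, [/\ [/\ shape T = nu, all (sorted leq) T & values_le m T],
    (forall r, lecount T r 0 = nth 0 mu r),
    (forall r a, lecount T r.+1 a <= lecount T r a.-1) & linked m nu T V].
Proof.
move=> pn pm pl num [hV nV] shV vV hc hd.
have B r : r <= m -> lecount V 0 (m - r) <= nth 0 nu r.
  by apply: (first_row_bound pl hV vV _ hc hd); exact: ltnW.
have nuS r : nth 0 nu r.+1 <= nth 0 nu r by case/andP: pn => pn _; exact: part_geq.
(* Needed because [T] has only [size nu] rows: the counts prescribed beyond them must vanish. *)
have low k j : size nu <= j + k -> lecount V k (m - j) = 0.
  move=> h; apply/eqP; rewrite -leqn0 -[k]add0n.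
  apply: leq_trans (ssyt_lecountD _ _ _ hV) _; rewrite -subnDA.
  have [jm|jm] := leqP (j + k) m; last by rewrite (_ : m - _ = 0) ?ssyt_lecount0 //; lia.
  by apply: leq_trans (B _ jm) _; rewrite nth_default.
have VS k a b : a <= b.+1 -> lecount V k.+1 a <= lecount V k b.
  by move=> ab; apply: leq_trans (ssyt_lecountS _ _ hV) _; apply: leq_lecount; lia.
pose f r j := if r < j then nth 0 nu r else lecount V (r - j) (m - j).
have fS r j : j < m -> f r j <= f r j.+1.
  move=> jm; rewrite /f; case: (ltngtP r j) => rj.
  - by rewrite ltnS (ltnW rj).
  - have -> : (r < j.+1) = false by lia.
    have -> : r - j = (r - j.+1).+1 by lia.
    by apply: VS; lia.
  - by rewrite rj ltnSn subnn; apply: B; exact: ltnW.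
pose T := [seq mkrow (f r) m | r <- iota 0 (size nu)].
have fm r : r < size nu -> f r m = nth 0 nu r.
  by move=> h; rewrite /f (leq_trans h (ltnW num)).
have shT : shape T = nu.
  by apply: map_iota_shape => r rn; rewrite mkrow_size ?fm //; exact: fS.
have Ts : size T = size nu by rewrite size_map size_iota.
have vT : values_le m T by apply/allP => _ /mapP[r _ ->]; exact: mkrow_all.
have NT r j : r < size nu -> lecount T r j = f r (minn j m).
  by move=> rn; rewrite /lecount nth_map_iota rn; exact: mkrow_count (fS r).
have NTm r j : j <= m -> lecount T r j = f r j.
  move=> jm; have [rn|rn] := ltnP r (size nu); first by rewrite NT // (minn_idPl jm).
  rewrite lecount_default ?Ts // /f; case: ltnP => rj; first by rewrite nth_default.
  by rewrite low //; lia.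
exists T; split=> //.
- by split=> //; apply/allP => _ /mapP[r _ ->]; exact: mkrow_sorted.
- move=> r; rewrite NTm // /f /= !subn0 -shV nth_shape; exact: (lecount_max _ vV (leqnn m)).
- move=> r a; have [am|am] := leqP a m; last first.
    rewrite !(lecount_max _ vT) -?nth_shape ?shT //; lia.
  rewrite !NTm; [|lia|lia]; rewrite /f; case: (ltngtP r.+1 a) => ra.
  + by have -> : r < a.-1 by lia.
  + have -> : (r < a.-1) = false by lia.
    have -> : r.+1 - a = (r - a).+1 by lia.
    case: (posnP a) => [->|a0]; first by rewrite /= !subn0; apply: VS; lia.
    have -> : r - a.-1 = (r - a).+1 by lia.
    by apply: leq_lecount; lia.
  + by rewrite -ra /= ltnn !subnn; apply: leq_lecount; lia.
- split=> [j k jm|r j rj].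
    by rewrite NTm // /f ltnNge leq_addr /= addKn.
  have [jm|jm] := leqP j m; first by rewrite NTm // /f rj.
  by rewrite (lecount_max _ vT (ltnW jm)) -nth_shape shT.
Qed.

Lemma linked_inj m nu T1 T2 V : is_part nu -> size nu <= m ->
  shape T1 = nu -> shape T2 = nu -> all (sorted leq) T1 -> all (sorted leq) T2 ->
  linked m nu T1 V -> linked m nu T2 V -> T1 = T2.
Proof.
move=> pn num sh1 sh2 s1 s2 [a1 b1] [a2 b2].
apply: rows_inj; [exact: shape_nil pn sh1|exact: shape_nil pn sh2|move=> r].
have sr T : all (sorted leq) T -> sorted leq (nth [::] T r).
  by move=> sT; have [i|i] := ltnP r (size T); [move/all_nthP: sT; apply|rewrite nth_default].
apply: sorted_count_inj => [||j]; [exact: sr|exact: sr|].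
rewrite -!/(lecount _ _ _); have [rj|jr] := ltnP r j; first by rewrite b1 // b2.
have [jm|jm] := leqP j m; first by rewrite -(subnKC jr) a1 // a2.
by rewrite !lecount_default //;
  [rewrite -(size_map size) -/(shape T2) sh2 | rewrite -(size_map size) -/(shape T1) sh1]; lia.
Qed.

(** * The pattern of the companion and the reading word of the contretableau *)

Lemma count_geq_flatten_nseq (g : nat -> nat) i s : (forall r, s < r -> g r = 0) ->
  count (geq i) (flatten [seq nseq (g r) r | r <- iota 1 s]) = \sum_(r < i) g r.+1.
Proof.
move=> g0; have -> : count (geq i) (flatten [seq nseq (g r) r | r <- iota 1 s]) =
    \sum_(0 <= r < s) (r < i) * g r.+1.
  elim: s {g0} => [|s IH]; first by rewrite big_geq.
  rewrite -(addn1 s) iotaD map_cat flatten_cat count_cat IH /= cats0 add1n addn1.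
  by rewrite big_nat_recr //= count_nseq.
rewrite -(big_mkord xpredT (fun r => g r.+1)).
have E a : \sum_(0 <= r < s + a) (r < i) * g r.+1 = \sum_(0 <= r < s) (r < i) * g r.+1.
  elim: a => [|a IH]; first by rewrite addn0.
  by rewrite addnS big_nat_recr //= IH g0 ?muln0 ?addn0 // ltnS leq_addr.
have F a : \sum_(0 <= r < i + a) (r < i) * g r.+1 = \sum_(0 <= r < i) g r.+1.
  elim: a => [|a IH].
    by rewrite addn0; apply: eq_big_nat => r /andP[_ ->]; rewrite mul1n.
  by rewrite addnS big_nat_recr //= IH ltnNge leq_addr mul0n addn0.
by rewrite -(E i) addnC F.
Qed.

(** Row [k] of the companion has as many entries [<= i] as [T] has letters [k] in its first [i]
    rows; the parts of [mu] supply the zeros. *)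
Lemma phi_companion mu T i j : (forall r, lecount T r 0 = nth 0 mu r) ->
  phi mu (companion T) i j = \sum_(r < i) lecount T r j.
Proof.
move=> h0; rewrite /phi.
have row k : count (geq i) (trow (companion T) k.+1) =
    \sum_(r < i) count_mem k.+1 (nth [::] T r).
  rewrite /trow /companion /=; set M := \max_(x <- _) x.
  have [kM|Mk] := ltnP k M.
    rewrite (nth_map 0) ?size_iota // nth_iota // add1n.
    rewrite count_geq_flatten_nseq //= => -[//|r] rT.
    by rewrite /trow /= nth_default.
  (* Beyond the maximum [M] the companion has no row and [T] has no letter. *)
  rewrite nth_default ?size_map ?size_iota // big1 // => r _.
  apply/eqP; rewrite -leqn0 leqNgt -has_count; apply/hasPn => x xr /=.
  have [rT|rT] := ltnP r (size T); last by move: xr; rewrite nth_default.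
  have : x <= M.
    apply: (leq_bigmax_seq (F := id) x) => //; apply/flattenP; exists (nth [::] T r) => //.
    exact: mem_nth.
  by move=> xM; apply/eqP; lia.
rewrite !big_add1 /= !big_mkord.
rewrite (eq_bigr (fun k : 'I_j => \sum_(r < i) count_mem k.+1 (nth [::] T r))); last first.
  by move=> k _; exact: row.
rewrite exchange_big /= -big_split /=.
apply: eq_bigr => r _; rewrite part_nth -h0 addnC.
elim: j => [|j IH]; first by rewrite big_ord0 addn0.
by rewrite big_ord_recr /= addnA IH lecountS.
Qed.

(** Two consecutive values of [h] differ by the contribution of a single row of [T], which [linked]
    identifies with a count of [V]. *)
Lemma Phat_companion m nu mu T V i k : (forall r, lecount T r 0 = nth 0 mu r) ->
  linked m nu T V -> i <= m ->
  Phat m (phi mu (companion T)) i k.+1 = lecount V k i.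
Proof.
move=> h0 lk im; rewrite /Phat !phi_companion // addnS subn1 /= big_ord_recr /= addKn.
by rewrite addnC addnC lk.1 ?subKn ?leq_subr.
Qed.

Lemma count_mem_flatten_nseq (d : nat -> nat) i m :
  count_mem i (flatten [seq nseq (d a) a | a <- iota 1 m]) = if 1 <= i <= m then d i else 0.
Proof.
elim: m => [|m IH]; first by case: ifP => //; lia.
rewrite -(addn1 m) iotaD map_cat flatten_cat count_cat IH /= cats0 add1n addn1 count_nseq /= eq_sym.
have [->|ne] := eqVneq i m.+1; first by rewrite ltnn leqnn mul1n.
by rewrite mul0n addn0; have -> : (0 < i <= m.+1) = (0 < i <= m) by lia.
Qed.

Lemma sorted_leq_count_mem s1 s2 : sorted leq s1 -> sorted leq s2 ->
  (forall a, count_mem a s1 = count_mem a s2) -> s1 = s2.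
Proof.
move=> h1 h2 h; apply: (sorted_eq leq_trans anti_leq) => //.
by apply/allP => x _ /=; rewrite h.
Qed.

Lemma reading_contretableau m P V : ssyt V -> values_le m V -> size V <= m ->
  (forall i k, i <= m -> P i k.+1 = lecount V k i) ->
  reading_word (contretableau m P) = revcompl m (read V).
Proof.
move=> hV vV sV hP; rewrite -[RHS]revK rev_revcompl_read /reading_word; congr rev.
(* When [i < m.+1 - r] the definition takes the value 0; by column strictness all entries of row
   [m - r] of [V] exceed [m - r], so the count is 0 as well. *)
have cp i r : 1 <= r <= m -> i <= m ->
    contre_part m P i r = lecount V 0 m - lecount V (m - r) i.
  move=> rm im; rewrite /contre_part hP // (_ : m.+1 - r = (m - r).+1); last by lia.
  case: ltnP => h; first by rewrite hP.
  have := ssyt_lecountD 0 (m - r) i hV; rewrite add0n (_ : i - _ = 0); last by lia.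
  by rewrite ssyt_lecount0 // leqn0 => /eqP ->.
set W := map _ V.
have row r : 1 <= r <= m ->
    rev [seq x <- nseq (contre_part m P m r) 0 ++
       flatten [seq nseq (contre_part m P (m - i) r
                          - contre_part m P (m - i + 1) r) i | i <- iota 1 m] | 0 < x] =
    nth [::] W (m - r).
  move=> rm; rewrite filter_cat.
  have -> : [seq x <- nseq (contre_part m P m r) 0 | 0 < x] = [::].
    by rewrite -(filter_pred0 (nseq (contre_part m P m r) 0)); apply: eq_in_filter => x /nseqP[->].
  set F := flatten _; have /all_filterP -> : all (fun x => 0 < x) F.
    apply/allP => x /flattenP[_ /mapP[a + ->]]; rewrite mem_iota => ha.
    by move=> /nseqP[-> _]; lia.
  have nW : nth [::] W (m - r) = [seq m.+1 - x | x <- nth [::] V (m - r)].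
    have [h|h] := ltnP (m - r) (size V); first by rewrite (nth_map [::]).
    by rewrite !nth_default ?size_map.
  rewrite nW cat0s -[RHS]revK; congr rev.
  have [sr r1] := ssyt_row (m - r) hV.
  apply: sorted_leq_count_mem => [||i].
  - exact: (sorted_flatten_nseq (fun i =>
      contre_part m P (m - i) r - contre_part m P (m - i + 1) r)).
  - rewrite rev_sorted; apply: homo_sorted sr => x y /= xy; exact: leq_sub2l.
  rewrite (count_mem_flatten_nseq (fun i =>
    contre_part m P (m - i) r - contre_part m P (m - i + 1) r)).
  rewrite count_rev count_map; case: ifP => im; last first.
    symmetry; apply/eqP; rewrite -leqn0 leqNgt -has_count; apply/hasPn => x xV /=.
    have := allP (values_leP _ _ vV (m - r)) _ xV; have := allP r1 _ xV => /=; lia.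
  have := compl_count (m - r) vV im; rewrite !cp; try lia.
  rewrite (_ : m - i.-1 = m - i + 1); last by lia.
  have h1 : lecount V (m - r) (m - i + 1) <= lecount V 0 m.
    have := ssyt_lecountD 0 (m - r) (m - i + 1) hV; rewrite add0n => /leq_trans; apply.
    by apply: leq_lecount; lia.
  have := leq_lecount V (m - r) (leq_addr 1 (m - i)).
  count_lia.
rewrite /rrword /contretableau -map_comp.
have -> : [seq ((fun r => rev [seq x <- r | 0 < x]) \o (fun r => nseq (contre_part m P m r) 0 ++
       flatten [seq nseq (contre_part m P (m - i) r
                          - contre_part m P (m - i + 1) r) i | i <- iota 1 m])) r | r <- iota 1 m]
   = rev [seq nth [::] W k | k <- iota 0 m].
  apply: (@eq_from_nth _ [::]); rewrite ?size_rev !size_map !size_iota // => r rm.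
  rewrite nth_rev ?size_map ?size_iota // !(nth_map 0) ?size_iota // ?nth_iota //; try lia.
  by rewrite /= row //; lia.
(* The top [m - size V] rows of the contretableau have no positive entry; the others are the
   complemented rows of [V] in reverse order. *)
rewrite -(subnKC sV) iotaD map_cat rev_cat flatten_cat.
have -> : [seq nth [::] W k | k <- iota 0 (size V)] = W.
  have -> : size V = size W by rewrite size_map.
  by rewrite map_nth_iota0 // take_size.
rewrite [X in flatten X ++ _](_ : _ = nseq (m - size V) [::]); last first.
  apply: (@eq_from_nth _ [::]); rewrite ?size_rev size_map size_iota ?size_nseq // => i im.
  rewrite nth_rev ?size_map ?size_iota // (nth_map 0) ?size_iota ?nth_nseq ?im; try lia.
  by rewrite nth_default // size_map nth_iota; lia.
by elim: (m - size V).
Qed.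

Lemma reading_rotate_compl m R : all (all (leq 1)) R -> values_le m R ->
  reading_word (rotate_compl m R) = revcompl m (read R).
Proof.
move=> pR vR; rewrite -[RHS]revK rev_revcompl_read /reading_word; congr rev.
rewrite /rrword /rotate_compl -map_comp -map_rev; congr flatten.
apply/eq_in_map => r; rewrite mem_rev => rR /=.
rewrite filter_cat.
have -> : forall k, [seq x <- nseq k 0 | 0 < x] = [::] by elim.
have /all_filterP -> : all (fun x => 0 < x) (rev [seq m.+1 - x | x <- r]).
  rewrite all_rev all_map; apply/allP => x xr /=.
  by have := allP (allP vR _ rR) _ xr => /=; lia.
by rewrite revK.
Qed.

Lemma part_inj s1 s2 : is_part s1 -> is_part s2 ->
  (forall r, nth 0 s1 r = nth 0 s2 r) -> s1 = s2.
Proof.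
move=> /andP[_ n1] /andP[_ n2] h.
apply: (@eq_from_nth _ 0) => [|i _]; last exact: h.
apply/eqP; rewrite eqn_leq; apply/andP; split; rewrite leqNgt; apply/negP => lt.
  by move: n1; rewrite -(@nth_default _ 0 s2 (size s2)) // -h mem_nth.
by move: n2; rewrite -(@nth_default _ 0 s1 (size s1)) // h mem_nth.
Qed.

Lemma all_leq1_revcompl m V : values_le m V -> all (leq 1) (revcompl m (read V)).
Proof. by move=> vV; apply: revcompl_gt0; rewrite all_read. Qed.

(** The Schützenberger involution preserves shapes and squares to the identity: [revcompl] is an
    involution compatible with Knuth equivalence, and a Knuth class contains one tableau. *)
Lemma ptab_revcompl m V (X := ptab (revcompl m (read V))) :
  tabl V -> values_le m V ->
  [/\ tabl X, shape X = shape V, values_le m X,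
      knuth_equiv (revcompl m (read V)) (read X) & ptab (revcompl m (read X)) = V].
Proof.
move=> hV vV; have [hX k] := ptabP (all_leq1_revcompl vV); rewrite -/X in hX k.
have vX : values_le m X.
  rewrite /values_le -all_read -(perm_all _ (knuth_perm k)); apply: revcompl_le.
  by rewrite all_read; case: hV => -[].
split=> //.
  have [pX _] := (tablP X).1 hX; have [pV _] := (tablP V).1 hV.
  apply: part_inj => // r; symmetry.
  exact: ssyt_revcompl_shape hV.1 hX.1 vV k r.
apply: ptab_unique => //.
rewrite -[X in knuth_equiv _ X](revcomplK (m := m)); last by rewrite all_read.
by apply: knuth_revcompl; [rewrite all_read|exact: knuth_sym].
Qed.

Lemma schutzenberger_ptab n R : tabl R -> values_le n.*2 R ->
  schutzenberger n R = ptab (revcompl n.*2 (read R)).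
Proof. by move=> [[_ pR _] _] vR; rewrite -reading_rotate_compl. Qed.

(** Weight and dominance pass along the Knuth equivalence from the word of the rotated complement of
    [V] to [X]. *)
Lemma LRdomP n nu lam mu X V : is_part lam -> is_part mu ->
  tabl X -> shape X = mu -> values_le n.*2 X -> ssyt V ->
  knuth_equiv (revcompl n.*2 (read V)) (read X) ->
  LRdom n nu lam mu X <->
  (forall i, 1 <= i ->
     part lam i + count (fun x => n.*2.+1 - x == i) (flatten V) = part nu i) /\
  dom_word lam (rev (revcompl n.*2 (read V))).
Proof.
move=> pl pm hX shX vX hV k; have [[_ pX _] _] := hX.
have rX : rrword X = rev (read X) by rewrite -reading_word_pos // /reading_word revK.
have cX i : count_mem i (rrword X) = count (fun x => n.*2.+1 - x == i) (flatten V).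
  rewrite rX count_rev -(permP (knuth_perm k)) count_rev count_map count_flatten_rev.
  exact: eq_count.
rewrite (knuth_dom lam k) -rX; split.
  by move=> [_ _ h /(dominantP _ pl)]; split=> // i i1; rewrite -cX h.
move=> [h1 h2]; split=> //.
- by rewrite -shX; have [_] := (tablP X).1 hX.
- by move=> i i1; rewrite cX h1.
- by apply/dominantP.
Qed.

Lemma LRP n nu mu lam T : is_part nu -> is_part mu -> included mu nu ->
  LR n nu mu lam T <->
  [/\ shape T = nu, all (sorted leq) T & values_le n.*2 T] /\
  [/\ forall r, lecount T r 0 = nth 0 mu r,
      forall r a, lecount T r.+1 a <= lecount T r a.-1,
      forall i, 1 <= i -> count_mem i (rrword T) = part lam i & yamanouchi (rrword T)].
Proof.
move=> pn pm inc; split=> [[/(semistandardP _ pn pm inc)[h1 h2 h3 h4] h5 h6 h7]|].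
  by split; split.
move=> [[h1 h2 h3] [h4 h5 h6 h7]]; split=> //.
by apply/semistandardP.
Qed.

Lemma Umap_companion n nu mu T V : (forall r, lecount T r 0 = nth 0 mu r) ->
  linked n.*2 nu T V -> ssyt V -> values_le n.*2 V -> size V <= n.*2 ->
  Umap n mu (companion T) = ptab (revcompl n.*2 (read V)).
Proof.
move=> h0 lk hV vV sV; rewrite -(@reading_contretableau _ (Phat n.*2 (phi mu (companion T))) V) //.
by move=> i k im; exact: Phat_companion lk im.
Qed.

(** * The Kwon and Sundaram properties *)

Lemma lecount0P T r a : reflect (forall x, x \in nth [::] T r -> a < x) (lecount T r a == 0).
Proof.
rewrite -leqn0 leqNgt -has_count; apply: (iffP hasPn) => h x /h /=; by rewrite -ltnNge.
Qed.

(** With [i = n.+1 - q], the Kwon condition on the [i]-th row forbids entries [<= (n - q).*2] there,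
    and [linked] carries this count to row [n + q] of [T]. *)
Lemma kwon_linked n nu T V : linked n.*2 nu T V ->
  kwon n V <-> forall q, 1 <= q <= n -> lecount T (n + q) q.*2 = 0.
Proof.
move=> [lk _]; have E q : 1 <= q <= n ->
    lecount T (n + q) q.*2 = lecount V (n - q) (n - q).*2.
  move=> qn; rewrite (_ : n + q = q.*2 + (n - q)); last by lia.
  by rewrite lk; [rewrite doubleB|lia].
split=> h q qn.
  rewrite E //; apply/eqP/lecount0P => x xV.
  by have := h (n - q).+1 _ x xV; lia.
move=> x xV; have qn' : 1 <= n.+1 - q <= n by lia.
have := h _ qn'; rewrite E // => /eqP/lecount0P/(_ x).
rewrite (_ : n - (n.+1 - q) = q.-1); last by lia.
by move=> /(_ xV); lia.
Qed.

Lemma sundaram_lecount n nu mu lam T : is_part nu -> is_part mu -> is_part lam ->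
  included mu nu -> even_part lam -> size nu <= n.*2 -> size mu <= n -> LR n nu mu lam T ->
  sundaram n lam T <-> forall q, 1 <= q <= n -> lecount T (n + q) q.*2 = 0.
Proof.
move=> pn pm pl inc ev num mun /(LRP _ _ _ pn pm inc)[[sh sT vT] [h0 hS hc yT]].
have Tn : size T <= n.*2 by rewrite -(size_map size) -/(shape T) sh.
have c0 i r : count_mem i (nth [::] T r) = 0 -> i \notin nth [::] T r.
  by move=> h; rewrite -has_pred1 has_count h.
split=> [h|h i il r rT].
  (* The stronger bound [q.*2.+1] supports an induction on [q]: column strictness excludes entries
     up to [q.*2.+2] from the next row, and the Sundaram property excludes [q.*2.+3]. At [q = 0],
     zeros are excluded by [size mu <= n]. *)
  suff H q : lecount T (n + q) q.*2.+1 = 0.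
    by move=> q _; apply/eqP; rewrite -leqn0 -(H q); exact: leq_lecount.
  have odd_row p : p.*2.+1 \notin nth [::] T (n + p).
    apply/negP => hin.
    have rT : n + p < size T.
      by rewrite ltnNge; apply: contraL hin => hs; rewrite nth_default.
    (* An occurrence of [p.*2.+1] makes that part of [lam] nonzero, so [p] is in the range of the
       Sundaram condition. *)
    have pl' : p <= (size lam)./2.
      suff : p.*2.+1 <= size lam by lia.
      rewrite leqNgt; apply/negP => hp.
      have := hc p.*2.+1 isT; rewrite part_nth nth_default // count_rrword // => /eqP.
      rewrite -leqn0 leqNgt -has_count => /hasPn/(_ p.*2.+1).
      rewrite /= eqxx => /(_ _) /negP; apply=> //.
      by apply/flattenP; exists (nth [::] T (n + p)) => //; exact: mem_nth.
    by have := h p pl' (n + p).+1 rT hin; lia.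
  elim: q => [|q IH]; rewrite lecountS; apply/eqP; rewrite addn_eq0 -leqn0; apply/andP; split.
  - by rewrite addn0 h0 nth_default.
  - by rewrite -leqn0 leqNgt -has_count has_pred1; exact: (odd_row 0).
  - by rewrite addnS; apply: leq_trans (hS _ _) _; rewrite doubleS /= IH.
  - by rewrite -leqn0 leqNgt -has_count has_pred1; exact: odd_row.
case: r rT => // r /= rT; rewrite /trow /= => hin.
rewrite ltnNge; apply/negP => nr.
have i2n : i < n.
  by have := allP (values_leP _ _ vT r) _ hin => /=; lia.
(* The hypothesis at [q = i.+1], propagated downwards by column strictness. It forces the offending
   row to be exactly [n + i]. *)
have low d : lecount T (n + i.+1 + d) i.+1.*2 = 0.
  elim: d => [|d IH]; first by rewrite addn0 h //; lia.
  apply/eqP; rewrite -leqn0 addnS; apply: leq_trans (hS _ _) _; rewrite -IH.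
  by apply: leq_lecount; lia.
have rn : r = n + i.
  apply/eqP; rewrite eqn_leq nr andbT leqNgt; apply/negP => lt.
  have := low (r - (n + i.+1)); rewrite subnKC; last by lia.
  by move=> /eqP/lecount0P/(_ _ hin); lia.
(* All letters [i.*2.+1] and [i.*2.+2] thus lie in the first [r.+1] rows. *)
have tot e : i.*2 < e <= i.+1.*2 -> count_mem e (flatten (take r.+1 T)) = part lam e.
  move=> he; rewrite -hc; last by lia.
  rewrite count_rrword; last by lia.
  rewrite -[in RHS](cat_take_drop r.+1 T) flatten_cat count_cat.
  rewrite [X in _ = _ + X](_ : _ = 0) ?addn0 //.
  apply: count_flatten0 => p; rewrite nth_drop; apply/eqP.
  rewrite -leqn0 leqNgt -has_count; apply/hasPn => x /=.
  have := low p; rewrite rn addnS addSn => /eqP/lecount0P hp /hp; lia.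
(* All the letters [i.*2.+2] must be matched by letters [i.*2.+1] in the first [r] rows. Evenness
   makes the totals equal, but one [i.*2.+1] lies in row [r]. *)
have := (yamanouchi_rows sT).1 yT i.*2.+1 r isT.
have /= := ev i.+1 isT; rewrite doubleS /= => e.
have t1 : count_mem i.*2.+1 (flatten (take r.+1 T)) = part lam i.*2.+1.
  by apply: tot; lia.
rewrite tot -?e -?t1 ?count_flatten_take; last lia.
apply/negP; rewrite -ltnNge -[X in X < _]addn0 ltn_add2l.
by rewrite -has_count has_pred1.
Qed.

(** * The bijection and its restriction *)

Lemma LR_image n nu mu lam T : 1 <= n -> is_part nu -> is_part mu -> is_part lam ->
  size nu <= n.*2 - 1 -> size mu <= n -> included mu nu -> LR n nu mu lam T ->
  exists V, [/\ [/\ tabl V, shape V = mu, values_le n.*2 V & linked n.*2 nu T V],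
    Umap n mu (companion T) = ptab (revcompl n.*2 (read V)),
    LRdom n nu lam mu (Umap n mu (companion T)) &
    schutzenberger n (Umap n mu (companion T)) = V].
Proof.
move=> n1 pn pm pl nun mun inc hT.
have [[sh sT vT] [h0 hS hc yT]] := (LRP _ _ _ pn pm inc).1 hT.
have num : size nu <= n.*2 by lia.
have [V [hV shV vV lk]] := linked_exists pn pm num sh sT vT h0 hS yT.
have sV : size V <= n.*2 by rewrite -(size_map size) -/(shape V) shV; lia.
have UE := Umap_companion h0 lk hV.1 vV sV.
exists V; split=> //; rewrite UE; have [hX shX vX k XV] := ptab_revcompl hV vV.
  apply/(LRdomP _ pl pm hX _ vX hV.1 k); first by rewrite shX.
  have Tm : size T <= n.*2 by rewrite -(size_map size) -/(shape T) sh.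
  have [H _] := linkedP Tm vT vV hV.1 lk num pl sT.
  by have [h1 h2] := H (conj hc yT); split=> // i i1; rewrite -h1 // drop0.
by rewrite schutzenberger_ptab.
Qed.

Lemma LR_preimage n nu mu lam X : 1 <= n -> is_part nu -> is_part mu -> is_part lam ->
  size nu <= n.*2 - 1 -> size mu <= n -> included mu nu -> LRdom n nu lam mu X ->
  exists2 T, LR n nu mu lam T & Umap n mu (companion T) = X.
Proof.
move=> n1 pn pm pl nun mun inc hX.
have [ssX vX _ _] := hX; have [shX _ _ _] := ssX.
have tX : tabl X by apply/tablP; rewrite shX.
have [hV shV vV k XV] := ptab_revcompl tX vX.
set V := ptab _ in hV shV vV k XV.
(* By involutivity, [X] lies in the Knuth class of the rotated complement of [V]. *)
have [_ _ _ k' _] := ptab_revcompl hV vV; rewrite XV in k'.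
have [hc hd] := (LRdomP nu pl pm tX shX vX hV.1 k').1 hX.
have num : size nu < n.*2 by lia.
rewrite shX in shV.
have [T [[sh sT vT] h0 hS lk]] := linked_inverse pn pm pl num hV shV vV hc hd.
have sV : size V <= n.*2 by rewrite -(size_map size) -/(shape V) shV; lia.
exists T; last by rewrite (Umap_companion h0 lk hV.1 vV sV).
apply/LRP => //; split=> //.
have Tm : size T <= n.*2 by rewrite -(size_map size) -/(shape T) sh ltnW.
have [_ H] := linkedP Tm vT vV hV.1 lk (ltnW num) pl sT.
have [|h1 h2] := H _; last by split.
by split; [move=> i i1; rewrite drop0 hc|exact: hd].
Qed.

(** The Schützenberger involution recovers [V] from the image, and [V] determines [T]. *)
Lemma LR_image_inj n nu mu lam T1 T2 : 1 <= n -> is_part nu -> is_part mu -> is_part lam ->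
  size nu <= n.*2 - 1 -> size mu <= n -> included mu nu ->
  LR n nu mu lam T1 -> LR n nu mu lam T2 ->
  Umap n mu (companion T1) = Umap n mu (companion T2) -> T1 = T2.
Proof.
move=> n1 pn pm pl nun mun inc hT1 hT2 E.
have [V1 [[_ _ _ lk1] _ _ S1]] := LR_image n1 pn pm pl nun mun inc hT1.
have [V2 [[_ _ _ lk2] _ _ S2]] := LR_image n1 pn pm pl nun mun inc hT2.
have V12 : V1 = V2 by rewrite -S1 -S2 E.
have [[sh1 s1 _] _] := (LRP _ _ _ pn pm inc).1 hT1.
have [[sh2 s2 _] _] := (LRP _ _ _ pn pm inc).1 hT2.
by apply: (linked_inj (m := n.*2) (V := V1) pn _ sh1 sh2 s1 s2 lk1); [lia|rewrite V12].
Qed.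

(** [lam] is [nu] minus the content of [X]; hence the sets united over [lam] are disjoint. *)
Lemma LRdom_part_inj n nu mu lam1 lam2 X : is_part lam1 -> is_part lam2 ->
  LRdom n nu lam1 mu X -> LRdom n nu lam2 mu X -> lam1 = lam2.
Proof.
move=> p1 p2 [_ _ h1 _] [_ _ h2 _]; apply: part_inj => // r.
by have := h1 r.+1 isT; rewrite -(h2 r.+1 isT) => /addIn.
Qed.

Theorem theorem3p6 (n : nat) (nu mu : seq nat) :
  1 <= n -> is_part nu -> is_part mu ->
  size nu <= n.*2 - 1 -> size mu <= n -> included mu nu ->
  (forall lam : seq nat,
     is_part lam -> even_part lam -> included lam nu ->
     set_bij (LRS n nu mu lam) (LRK n nu lam mu) (Umap n mu \o companion)) /\
  set_bij (LRSeven n nu mu) (LRKeven n nu mu) (Umap n mu \o companion).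
Proof.
move=> n1 pn pm nun mun inc.
have num : size nu <= n.*2 by lia.
(* Both properties reduce to the same vanishing counts of [T], because the Schützenberger image of
   [Umap n mu (companion T)] is [V]. *)
have SK lam T : is_part lam -> even_part lam -> LR n nu mu lam T ->
    sundaram n lam T <-> kwon n (schutzenberger n (Umap n mu (companion T))).
  move=> pl ev hT; have [V [[_ _ _ lk] _ _ ->]] := LR_image n1 pn pm pl nun mun inc hT.
  by rewrite (kwon_linked lk) (sundaram_lecount pn pm pl inc ev num mun hT).
have fwd lam T : is_part lam -> even_part lam -> LRS n nu mu lam T ->
    LRK n nu lam mu (Umap n mu (companion T)).
  move=> pl ev [hT sT]; split; last exact: ((SK _ _ pl ev hT).1 sT).
  by have [V []] := LR_image n1 pn pm pl nun mun inc hT.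
have bwd lam X : is_part lam -> even_part lam -> LRK n nu lam mu X ->
    exists2 T, LRS n nu mu lam T & Umap n mu (companion T) = X.
  move=> pl ev [hX kX]; have [T hT E] := LR_preimage n1 pn pm pl nun mun inc hX.
  by exists T => //; split=> //; apply/(SK _ _ pl ev hT); rewrite E.
split=> [lam pl ev _|]; split.
- by move=> T /(fwd _ _ pl ev).
- move=> T1 T2 /set_mem[h1 _] /set_mem[h2 _] /=.
  exact: LR_image_inj n1 pn pm pl nun mun inc h1 h2.
- by move=> X /(bwd _ _ pl ev)[T hT <-]; exists T.
- by move=> T [lam [pl ev] hT]; exists lam => //; exact: fwd.
- move=> T1 T2 /set_mem[lam1 [p1 e1] h1] /set_mem[lam2 [p2 e2] h2] /= E.
  have [hX1 _] := fwd _ _ p1 e1 h1; have [hX2 _] := fwd _ _ p2 e2 h2.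
  (* The common image determines [lam], which reduces injectivity on the union to a single [lam]. *)
  rewrite E in hX1; have L := LRdom_part_inj p1 p2 hX1 hX2; subst lam2.
  exact: LR_image_inj n1 pn pm p1 nun mun inc h1.1 h2.1 E.
- move=> X [lam [pl ev] /(bwd _ _ pl ev)[T hT <-]]; exists T => //.
  by exists lam.
Qed.
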